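(* Let $p,q\in\mathbb{C}$, let $\Delta=\sqrt{p^2-4q}$, and for $n\in\mathbb{N}$ let $$W_n(p,q)=\prod_{j=1}^{n}\left\{e^{-p/j}\left(1+\frac{p}{j}+\frac{q}{j^2}\right)\right\}.$$ Then, as $n\to\infty$, $$W_n(p,q)\sim\frac{e^{-p\gamma}}{\Gamma\left(1+\frac12 p+\frac12\Delta\right)\Gamma\left(1+\frac12 p-\frac12\Delta\right)}\exp\left(\sum_{j=1}^{\infty}\frac{a_j(p,q)}{(n+1)^j}\right),$$ where the coefficients $a_j(p,q)$ are given by $$a_1(p,q)=\frac12 p^2-q$$ and, for $j\ge 2$, $$a_j(p,q)=\frac{pB_j}{j}+\frac{(-1)^{j+1}\left(B_{j+1}\left(\frac12 p+\frac12\Delta\right)+B_{j+1}\left(\frac12 p-\frac12\Delta\right)-2B_{j+1}\right)}{j(j+1)}.$$ Thus, as $n\to\infty$, $$W_n(p,q)\sim\frac{e^{-p\gamma}}{\Gamma\left(1+\frac12 p+\frac12\Delta\right)\Gamma\left(1+\frac12 p-\frac12\Delta\right)}\exp\left(\frac{\frac12p^2-q}{n+1}+\frac{-\frac16p^3+\frac12pq+\frac14p^2-\frac12q}{(n+1)^2}+\frac{\frac1{12}p^4-\frac13p^2q+\frac16q^2-\frac16p^3+\frac12pq+\frac1{12}p^2-\frac16q}{(n+1)^3}+\cdots\right).$$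
   Context: $\mathbb{N}=\{1,2,3,\ldots\}$. $\gamma=\lim_{n\to\infty}\left(\sum_{k=1}^n\frac1k-\ln n\right)$ is the Euler--Mascheroni constant and $\Gamma$ is the gamma function; the reciprocal $1/\Gamma$ is the usual entire function (equal to $0$ at the poles of $\Gamma$). $\Delta$ denotes either square root of $p^2-4q$ (all expressions are symmetric under $\Delta\mapsto-\Delta$). The Bernoulli polynomials $B_n(t)$ are defined by $\frac{ze^{tz}}{e^z-1}=\sum_{n=0}^\infty B_n(t)\frac{z^n}{n!}$, and the Bernoulli numbers are $B_n=B_n(0)$. The relation $\sim$ denotes an asymptotic expansion in the usual (Poincaré) sense: $F(n)\sim C\exp\left(\sum_{j\ge1}c_j(n+1)^{-j}\right)$ means that for every $N\ge1$, $F(n)=C\exp\left(\sum_{j=1}^{N}c_j(n+1)^{-j}+O(n^{-N-1})\right)$ as $n\to\infty$. The series need not converge. *)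

(* Defs.v *)
From Stdlib Require Import Reals ZArith ClassicalEpsilon.
From Coquelicot Require Export Coquelicot.

Open Scope R_scope.
Open Scope C_scope.

Definition Cexp (z : C) : C :=
  (exp (Re z) * cos (Im z), exp (Re z) * sin (Im z))%R.

(* f 0 * f 1 * ... * f (n - 1) *)
Fixpoint Cprod (f : nat -> C) (n : nat) : C :=
  match n with
  | O => 1
  | S k => Cprod f k * f k
  end.

(* c 1 + ... + c N *)
Definition Csum1 (c : nat -> C) (N : nat) : C :=
  sum_n_m (G := C_AbelianMonoid) c 1 N.

Definition euler_gamma : R :=
  real (Lim_seq (fun n => (sum_n_m (fun k => / INR k) 1 n - ln (INR n))%R)).

(* Euler's integral of t^(s-1) e^(-t) over (0, +oo), meant for Re s > 0. *)
Definition Gamma_integral (s : C) : C :=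
  RInt_gen (V := C_R_CompleteNormedModule)
    (fun t : R => Cexp ((s - 1) * ln t) * exp (- t))
    (at_right 0%R) (Rbar_locally p_infty).

(* The least m with Re z + m > 0 : [up r] is the integer with r < up r <= r + 1. *)
Definition Gamma_shift (z : C) : nat := Z.to_nat (up (- Re z)).

(* The entire function 1/Gamma, through
     Gamma z = Gamma (z + m) / (z (z + 1) ... (z + m - 1)),  Re z + m > 0.
   It is the product in the numerator that makes it vanish at 0, -1, -2, ... *)
Definition Rgamma (z : C) : C :=
  Cprod (fun k => z + INR k) (Gamma_shift z)
    / Gamma_integral (z + INR (Gamma_shift z)).

(* z e^(tz) / (e^z - 1) = sum_n B_n(t) z^n / n! near z = 0; the point z = 0 is
   left out because there the left-hand side is a removable singularity. *)
Definition bernoulli_generating (B : nat -> C -> C) : Prop :=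
  forall t : C, exists r : R, (0 < r)%R /\
    forall z : C, z <> 0 -> (Cmod z < r)%R ->
      is_series (K := C_AbsRing) (V := C_NormedModule)
        (fun n => B n t * (z ^ n / INR (fact n)))
        (z * Cexp (t * z) / (Cexp z - 1)).

(* The family determined by its generating function: by uniqueness of power
   series coefficients, at most one B satisfies [bernoulli_generating]. *)
Definition bernoulli_poly : nat -> C -> C :=
  epsilon (inhabits (fun _ _ => RtoC 0)) bernoulli_generating.

Definition bernoulli (n : nat) : C := bernoulli_poly n 0.

(* F(n) ~ K exp (sum_(j >= 1) c_j (n+1)^(-j)) in the sense of Poincare: for all
   N >= 1, F(n) = K exp (sum_(1 <= j <= N) c_j (n+1)^(-j) + O(n^(-N-1))). *)
Definition exp_asymptotic (F : nat -> C) (K : C) (c : nat -> C) : Prop :=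
  forall N : nat, (1 <= N)%nat ->
    exists err : nat -> C,
      (exists M : R, eventually (fun n =>
         (Cmod (err n) <= M / INR n ^ (N + 1))%R)) /\
      eventually (fun n =>
         F n = K * Cexp (Csum1 (fun j => c j / INR (n + 1) ^ j) N + err n)).

Definition W (p q : C) (n : nat) : C :=
  Cprod (fun k => let j := INR (S k) in
           Cexp (- p / j) * (1 + p / j + q / j ^ 2)) n.

Definition W_const (p Delta : C) : C :=
  Cexp (- p * euler_gamma)
    * Rgamma (1 + p / 2 + Delta / 2) * Rgamma (1 + p / 2 - Delta / 2).

(* The value at j = 0 is irrelevant. *)
Definition W_coef (p q Delta : C) (j : nat) : C :=
  if Nat.leb j 1 then p ^ 2 / 2 - q
  else p * bernoulli j / INR j
       + (- (1)) ^ (j + 1)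
         * (bernoulli_poly (j + 1) (p / 2 + Delta / 2)
            + bernoulli_poly (j + 1) (p / 2 - Delta / 2)
            - 2 * bernoulli (j + 1))
         / (INR j * INR (j + 1)).

(* Main.v *)
(* Write u, v = (p +- Delta) / 2, so that 1 + p/j + q/j^2 = (1 + u/j) (1 + v/j).  Let
   S n = sum_(1 <= j <= N) a_j (n + 1)^(-j).  The recurrence
   sum_k binom(m+1, k) B_k(t) = (m+1) t^m, that is (e^z - 1)/z * z e^(tz)/(e^z - 1) = e^(tz),
   says exactly that S n - S (n-1) and -p/n + log (1 + u/n) + log (1 + v/n) have the same
   expansion in 1/n up to order N + 1.  Hence W_n exp (- S n) has consecutive ratios
   exp (O(n^(-N-2))), so it converges to some L with W_n = L exp (S n + O(n^(-N-1))), and L is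
   the limit of W_n.  By Gauss's product formula, derived from Euler's integral by comparing
   e^(-t) with (1 - t/n)^n, this limit is e^(-p gamma) / (Gamma (1 + u) Gamma (1 + v)).  No
   Stirling expansion is needed. *)
Require Import Defs.
From Stdlib Require Import Reals Lra Lia Arith Factorial ClassicalEpsilon.
From Coquelicot Require Import Coquelicot.

Open Scope R_scope.
Open Scope C_scope.

(** Everything stays multiplicative. A logarithm is taken only of a single factor close to 1, and
    consecutive ratios are stated in the form [Cexp e], so no branch of the logarithm of [W] is ever
    followed. This also covers the degenerate case where some [1 + u/j] is 0: then [W] is eventually
    0, and so is the constant, since [1/Gamma] vanishes at the corresponding pole. The factor
    [e^(-p/n)] removes the term in [1/n] from the logarithm of a ratio. The coefficient of [y^(r+2)]
    then involves only the exponents' coefficients up to index [r+1], a triangular system which the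
    Bernoulli recurrence solves in closed form; N coefficients thus suffice up to order N + 1. Two
    objects are given only indirectly. The Bernoulli family is chosen by [epsilon], so one such
    family has to be built before the chosen one can be identified by uniqueness of power series.
    Gamma is an integral only in the right half-plane, so Gauss's formula is proved there and
    carried to all arguments by the functional equation, written for [1/Gamma] so that poles become
    zeros. *)

Lemma C_eq (z w : C) : Re z = Re w -> Im z = Im w -> z = w.
Proof. destruct z, w; simpl; intros -> ->; reflexivity. Qed.

Lemma im_le_Cmod (z : C) : (Rabs (Im z) <= Cmod z)%R.
Proof.
  apply Rle_trans with (2 := Rmax_Cmod z). apply Rmax_r.
Qed.

Lemma Cmod_le_re_im (z : C) : (Cmod z <= Rabs (Re z) + Rabs (Im z))%R.
Proof.
  assert (E : z = RtoC (Re z) + Ci * RtoC (Im z)).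
  { apply C_eq; unfold Ci, Cplus, Cmult, RtoC, Re, Im; simpl; ring. }
  rewrite E at 1. eapply Rle_trans; [apply Cmod_triangle|].
  rewrite Cmod_mult, !Cmod_R, Cmod_Ci. lra.
Qed.

(** * The complex exponential *)

Lemma Cexp_plus (z w : C) : Cexp (z + w) = Cexp z * Cexp w.
Proof.
  unfold Cexp; apply C_eq; rewrite re_plus, im_plus; simpl;
    rewrite exp_plus, ?cos_plus, ?sin_plus; ring.
Qed.

Lemma Cexp_0 : Cexp 0 = 1.
Proof.
  unfold Cexp; apply C_eq; simpl; rewrite exp_0, ?cos_0, ?sin_0; ring.
Qed.

Lemma Cmod_Cexp (z : C) : Cmod (Cexp z) = exp (Re z).
Proof.
  unfold Cmod, Cexp; simpl.
  set (e := exp (Re z)).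
  replace (_ + _)%R with (e * e)%R.
  - apply sqrt_square. left. apply exp_pos.
  - generalize (sin2_cos2 (Im z)). unfold Rsqr. intros H.
    replace (e * e)%R with (e * e * (sin (Im z) * sin (Im z) + cos (Im z) * cos (Im z)))%R
      by (rewrite H; ring). ring.
Qed.

Lemma Cexp_neq_0 (z : C) : Cexp z <> 0.
Proof.
  apply Cmod_gt_0. rewrite Cmod_Cexp. apply exp_pos.
Qed.

Lemma Cexp_opp (z : C) : Cexp (- z) = / Cexp z.
Proof.
  assert (H : Cexp (- z) * Cexp z = 1).
  { rewrite <- Cexp_plus, Cplus_comm, Cplus_opp_r. apply Cexp_0. }
  rewrite <- (Cmult_1_l (/ Cexp z)), <- H. field. apply Cexp_neq_0.
Qed.

Lemma Cexp_RtoC (x : R) : Cexp x = exp x.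
Proof.
  apply C_eq; unfold Cexp, RtoC; simpl; rewrite ?cos_0, ?sin_0; ring.
Qed.

(** * Limits of complex sequences *)

(** Convergence by coordinates lets the real lemmas on [is_lim_seq] be reused; [is_series_Clim]
    connects it with the series in [bernoulli_generating]. *)
Definition Clim (x : nat -> C) (l : C) : Prop :=
  is_lim_seq (fun n => Re (x n)) (Re l) /\ is_lim_seq (fun n => Im (x n)) (Im l).

Lemma Clim_unique (x : nat -> C) (l l' : C) : Clim x l -> Clim x l' -> l = l'.
Proof.
  intros [H1 H2] [H3 H4].
  apply is_lim_seq_unique in H1, H2, H3, H4.
  apply C_eq; congruence.
Qed.

Lemma Clim_ext_loc (x y : nat -> C) (l : C) :
  eventually (fun n => x n = y n) -> Clim x l -> Clim y l.
Proof.
  intros [N H] [H1 H2]; split.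
  - apply is_lim_seq_ext_loc with (2 := H1). exists N; intros; rewrite H; auto.
  - apply is_lim_seq_ext_loc with (2 := H2). exists N; intros; rewrite H; auto.
Qed.

Lemma Clim_ext (x y : nat -> C) (l : C) : (forall n, x n = y n) -> Clim x l -> Clim y l.
Proof. intros H. apply Clim_ext_loc. exists O; auto. Qed.

Lemma Clim_const (c : C) : Clim (fun _ => c) c.
Proof. split; apply is_lim_seq_const. Qed.

Lemma Clim_RtoC (x : nat -> R) (l : R) : is_lim_seq x l -> Clim (fun n => RtoC (x n)) l.
Proof. intros H; split; simpl; [exact H | apply is_lim_seq_const]. Qed.

Lemma Clim_plus (x y : nat -> C) (l m : C) :
  Clim x l -> Clim y m -> Clim (fun n => x n + y n) (l + m).
Proof. intros [? ?] [? ?]; split; apply is_lim_seq_plus'; auto. Qed.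

Lemma Clim_mult (x y : nat -> C) (l m : C) :
  Clim x l -> Clim y m -> Clim (fun n => x n * y n) (l * m).
Proof.
  intros [? ?] [? ?]; split; simpl.
  - apply is_lim_seq_minus'; apply is_lim_seq_mult'; auto.
  - apply is_lim_seq_plus'; apply is_lim_seq_mult'; auto.
Qed.

Lemma Clim_opp (x : nat -> C) (l : C) : Clim x l -> Clim (fun n => - x n) (- l).
Proof.
  intros H. apply (Clim_mult _ _ (- (1)) _ (Clim_const _)) in H.
  replace (- l) with (- (1) * l) by ring.
  apply Clim_ext with (2 := H). intros n; ring.
Qed.

Lemma Clim_minus (x y : nat -> C) (l m : C) :
  Clim x l -> Clim y m -> Clim (fun n => x n - y n) (l - m).
Proof. intros Hx Hy. apply Clim_plus; [exact Hx | apply Clim_opp, Hy]. Qed.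

Lemma Clim_Cexp (x : nat -> C) (l : C) : Clim x l -> Clim (fun n => Cexp (x n)) (Cexp l).
Proof.
  intros [H1 H2]; split; simpl; apply is_lim_seq_mult'.
  - apply (is_lim_seq_continuous exp); [apply derivable_continuous_pt, derivable_pt_exp | auto].
  - apply (is_lim_seq_continuous cos); [apply continuity_cos | auto].
  - apply (is_lim_seq_continuous exp); [apply derivable_continuous_pt, derivable_pt_exp | auto].
  - apply (is_lim_seq_continuous sin); [apply continuity_sin | auto].
Qed.

Lemma Clim_incr_n (x : nat -> C) (k : nat) (l : C) :
  Clim x l <-> Clim (fun n => x (n + k)%nat) l.
Proof.
  unfold Clim.
  rewrite (is_lim_seq_incr_n (fun n => Re (x n)) k), (is_lim_seq_incr_n (fun n => Im (x n)) k).
  reflexivity.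
Qed.

Lemma is_lim_seq_0_abs_le (u v : nat -> R) :
  eventually (fun n => (Rabs (u n) <= v n)%R) -> is_lim_seq v 0%R -> is_lim_seq u 0%R.
Proof.
  intros H Hv. apply is_lim_seq_abs_0.
  apply is_lim_seq_le_le_loc with (u := fun _ => 0%R) (w := v); auto.
  - destruct H as [N H]; exists N; intros n Hn; split; [apply Rabs_pos | auto].
  - apply is_lim_seq_const.
Qed.

Lemma Clim_Cmod_le (x : nat -> C) (l : C) (v : nat -> R) :
  eventually (fun n => (Cmod (x n - l) <= v n)%R) -> is_lim_seq v 0%R -> Clim x l.
Proof.
  intros H Hv.
  assert (aux : forall (f : C -> R), (forall z, (Rabs (f z) <= Cmod z)%R) ->
    (forall z w, f (z - w) = (f z - f w)%R) -> is_lim_seq (fun n => f (x n)) (f l)).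
  { intros f Hf Hm.
    apply is_lim_seq_ext with (u := fun n => ((f (x n) - f l) + f l)%R); [intros; ring|].
    replace (Finite (f l)) with (Finite (0 + f l)) by (f_equal; ring).
    apply is_lim_seq_plus'; [|apply is_lim_seq_const].
    apply is_lim_seq_0_abs_le with (2 := Hv).
    destruct H as [N H]; exists N; intros n Hn.
    rewrite <- Hm. eapply Rle_trans; [apply Hf | auto]. }
  split; apply aux.
  - apply re_le_Cmod.
  - intros; simpl; reflexivity.
  - apply im_le_Cmod.
  - intros; simpl; reflexivity.
Qed.

Lemma Clim_Cmod_minus (x : nat -> C) (l : C) :
  Clim x l -> is_lim_seq (fun n => Cmod (x n - l)) 0%R.
Proof.
  intros [H1 H2].
  apply is_lim_seq_0_abs_le with
    (v := fun n => (Rabs (Re (x n) - Re l) + Rabs (Im (x n) - Im l))%R).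
  - exists O; intros n _. rewrite Rabs_pos_eq by apply Cmod_ge_0. apply (Cmod_le_re_im (x n - l)).
  - replace (Finite 0) with (Finite (Rabs (Re l - Re l) + Rabs (Im l - Im l)))
      by (f_equal; rewrite !Rminus_diag, Rabs_R0; ring).
    apply is_lim_seq_plus'.
    + apply (is_lim_seq_abs _ (Finite (Re l - Re l))).
      apply is_lim_seq_minus'; [auto | apply is_lim_seq_const].
    + apply (is_lim_seq_abs _ (Finite (Im l - Im l))).
      apply is_lim_seq_minus'; [auto | apply is_lim_seq_const].
Qed.

Lemma Clim_Cmod (x : nat -> C) (l : C) : Clim x l -> is_lim_seq (fun n => Cmod (x n)) (Cmod l).
Proof.
  intros H. apply Clim_Cmod_minus in H.
  apply is_lim_seq_ext with (u := fun n => ((Cmod (x n) - Cmod l) + Cmod l)%R); [intros; ring|].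
  replace (Finite (Cmod l)) with (Finite (0 + Cmod l)) by (f_equal; ring).
  apply is_lim_seq_plus'; [|apply is_lim_seq_const].
  apply is_lim_seq_0_abs_le with (2 := H).
  exists O; intros n _.
  assert (H1 := Cmod_triangle (x n - l) l). replace (x n - l + l) with (x n) in H1 by ring.
  assert (H2 := Cmod_triangle (- (x n - l)) (x n)).
  replace (- (x n - l) + x n) with l in H2 by ring. rewrite Cmod_opp in H2.
  apply Rabs_le. lra.
Qed.

Lemma Clim_cauchy (x : nat -> C) (r : nat -> R) :
  is_lim_seq r 0%R -> eventually (fun n => forall m, (n <= m)%nat -> (Cmod (x m - x n) <= r n)%R) ->
  exists l, Clim x l.
Proof.
  intros Hr [N0 H].
  assert (aux : forall (f : C -> R), (forall z, (Rabs (f z) <= Cmod z)%R) ->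
    (forall z w, f (z - w) = (f z - f w)%R) -> ex_finite_lim_seq (fun n => f (x n))).
  { intros f Hf Hm. apply ex_lim_seq_cauchy_corr. intros eps.
    apply is_lim_seq_spec in Hr.
    destruct (Hr (pos_div_2 eps)) as [N1 H1].
    set (N := max N0 N1). exists N.
    assert (aux : forall n, (N <= n)%nat -> (Rabs (f (x n) - f (x N)) < eps / 2)%R).
    { intros n Hn. rewrite <- Hm. eapply Rle_lt_trans; [apply Hf|].
      eapply Rle_lt_trans; [apply (H N); [unfold N; lia | exact Hn]|].
      specialize (H1 N). rewrite Rminus_0_r in H1.
      eapply Rle_lt_trans; [apply Rle_abs|]. apply H1; unfold N; lia. }
    intros n m Hn Hm'.
    replace (f (x n) - f (x m))%R with ((f (x n) - f (x N)) - (f (x m) - f (x N)))%R by ring.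
    eapply Rle_lt_trans; [apply Rabs_triang|]. rewrite Rabs_Ropp.
    assert (A1 := aux n Hn). assert (A2 := aux m Hm').
    lra. }
  destruct (aux Re re_le_Cmod (fun z w => eq_refl)) as [a Ha].
  destruct (aux Im im_le_Cmod (fun z w => eq_refl)) as [b Hb].
  exists (a, b). split; assumption.
Qed.

Lemma Cmod_le_of_Clim (x : nat -> C) (l : C) (M : R) :
  Clim x l -> eventually (fun n => (Cmod (x n) <= M)%R) -> (Cmod l <= M)%R.
Proof.
  intros H HM. apply Clim_Cmod in H.
  apply (is_lim_seq_le_loc _ _ (Finite (Cmod l)) (Finite M)) with (2 := H) (3 := is_lim_seq_const M).
  exact HM.
Qed.

(** * Finite complex sums *)

Definition Csum (a : nat -> C) (n : nat) : C := sum_n (G := C_AbelianMonoid) a n.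

Lemma Csum_O (a : nat -> C) : Csum a 0 = a O.
Proof. apply (sum_O (G := C_AbelianMonoid)). Qed.

Lemma Csum_S (a : nat -> C) (n : nat) : Csum a (S n) = Csum a n + a (S n).
Proof. apply (sum_Sn (G := C_AbelianMonoid)). Qed.

Lemma Csum_ext (a b : nat -> C) (n : nat) :
  (forall k, (k <= n)%nat -> a k = b k) -> Csum a n = Csum b n.
Proof. apply (sum_n_ext_loc (G := C_AbelianMonoid)). Qed.

Lemma Csum_plus (a b : nat -> C) (n : nat) :
  Csum (fun k => a k + b k) n = Csum a n + Csum b n.
Proof. apply (sum_n_plus (G := C_AbelianMonoid) a b n). Qed.

Lemma Csum_mult_l (c : C) (a : nat -> C) (n : nat) :
  Csum (fun k => c * a k) n = c * Csum a n.
Proof. apply (sum_n_mult_l (K := C_Ring) c a n). Qed.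

Lemma Csum_minus (a b : nat -> C) (n : nat) :
  Csum (fun k => a k - b k) n = Csum a n - Csum b n.
Proof.
  replace (Csum a n - Csum b n) with (Csum a n + (- (1)) * Csum b n) by ring.
  rewrite <- Csum_mult_l, <- Csum_plus. apply Csum_ext; intros; ring.
Qed.

Lemma Csum_switch (a : nat -> nat -> C) (m n : nat) :
  Csum (fun i => Csum (a i) n) m = Csum (fun j => Csum (fun i => a i j) m) n.
Proof. apply (sum_n_switch (G := C_AbelianMonoid)). Qed.

Lemma Cmod_Csum (a : nat -> C) (n : nat) :
  (Cmod (Csum a n) <= sum_n (fun k => Cmod (a k)) n)%R.
Proof.
  induction n as [|n IH].
  - rewrite Csum_O, sum_O. apply Rle_refl.
  - rewrite Csum_S, sum_Sn. eapply Rle_trans; [apply Cmod_triangle|].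
    apply Rplus_le_compat_r, IH.
Qed.

Lemma Csum_zero (a : nat -> C) (n : nat) :
  (forall k, (k <= n)%nat -> a k = 0) -> Csum a n = 0.
Proof.
  intros H; induction n as [|n IH].
  - rewrite Csum_O. apply H; lia.
  - rewrite Csum_S, IH, H by (intros; try apply H; lia). ring.
Qed.

Lemma Csum_single (a : nat -> C) (k n : nat) :
  (k <= n)%nat -> (forall i, (i <= n)%nat -> i <> k -> a i = 0) -> Csum a n = a k.
Proof.
  revert k; induction n as [|n IH]; intros k Hk H.
  - rewrite Csum_O. replace k with O by lia. reflexivity.
  - rewrite Csum_S. destruct (Nat.eq_dec k (S n)) as [->|Hne].
    + rewrite Csum_zero by (intros; apply H; lia). ring.
    + rewrite (IH k), (H (S n)); try lia; [ring|]. intros; apply H; lia.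
Qed.

(** * Derivatives along the real line *)

(** Complex functions are only ever differentiated along a real parameter, so a derivative by
    coordinates is enough and holomorphy never enters. *)
Definition Cderive (f : R -> C) (t : R) (l : C) : Prop :=
  is_derive (fun x => Re (f x)) t (Re l) /\ is_derive (fun x => Im (f x)) t (Im l).

Lemma Cderive_eq (f : R -> C) (t : R) (l l' : C) : Cderive f t l -> l = l' -> Cderive f t l'.
Proof. intros H <-; exact H. Qed.

Lemma Cderive_ext (f g : R -> C) (t : R) (l : C) :
  (forall x, f x = g x) -> Cderive f t l -> Cderive g t l.
Proof.
  intros H [H1 H2]; split.
  - apply is_derive_ext with (2 := H1). intros; rewrite H; reflexivity.
  - apply is_derive_ext with (2 := H2). intros; rewrite H; reflexivity.
Qed.

Lemma Cderive_const (c : C) (t : R) : Cderive (fun _ => c) t 0.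
Proof. split; apply (is_derive_const (V := R_NormedModule)). Qed.

Lemma Cderive_RtoC (f : R -> R) (t l : R) : is_derive f t l -> Cderive (fun x => RtoC (f x)) t l.
Proof. intros H; split; [exact H | apply (is_derive_const (V := R_NormedModule) 0%R)]. Qed.

Lemma Cderive_plus (f g : R -> C) (t : R) (l m : C) :
  Cderive f t l -> Cderive g t m -> Cderive (fun x => f x + g x) t (l + m).
Proof. intros [? ?] [? ?]; split; apply (is_derive_plus (V := R_NormedModule)); assumption. Qed.

Lemma is_derive_Rmult (f g : R -> R) (t l m : R) :
  is_derive f t l -> is_derive g t m ->
  is_derive (fun x => (f x * g x)%R) t (l * g t + f t * m)%R.
Proof. intros H1 H2. apply (is_derive_mult f g t l m H1 H2). intros; apply Rmult_comm. Qed.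

Lemma Cderive_mult (f g : R -> C) (t : R) (l m : C) :
  Cderive f t l -> Cderive g t m -> Cderive (fun x => f x * g x) t (l * g t + f t * m).
Proof.
  intros [H1 H2] [H3 H4]; split.
  - apply is_derive_ext with (f := fun x => (Re (f x) * Re (g x) - Im (f x) * Im (g x))%R);
      [reflexivity|].
    replace (Re _) with ((Re l * Re (g t) + Re (f t) * Re m) - (Im l * Im (g t) + Im (f t) * Im m))%R
      by (unfold Re, Im, Cplus, Cmult; simpl; ring).
    apply (is_derive_minus (V := R_NormedModule)); apply is_derive_Rmult; auto.
  - apply is_derive_ext with (f := fun x => (Re (f x) * Im (g x) + Im (f x) * Re (g x))%R);
      [reflexivity|].
    replace (Im _) with ((Re l * Im (g t) + Re (f t) * Im m) + (Im l * Re (g t) + Im (f t) * Re m))%R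
      by (unfold Re, Im, Cplus, Cmult; simpl; ring).
    apply (is_derive_plus (V := R_NormedModule)); apply is_derive_Rmult; auto.
Qed.

Lemma Cderive_Cmult_l (c : C) (f : R -> C) (t : R) (l : C) :
  Cderive f t l -> Cderive (fun x => c * f x) t (c * l).
Proof.
  intros H. apply Cderive_eq with (0 * f t + c * l); [|ring].
  apply (Cderive_mult (fun _ => c)); [apply Cderive_const | exact H].
Qed.

Lemma Cderive_Cexp (f : R -> C) (t : R) (l : C) :
  Cderive f t l -> Cderive (fun x => Cexp (f x)) t (l * Cexp (f t)).
Proof.
  intros [H1 H2]; split; unfold Cexp; simpl.
  - eapply is_derive_ext with (f := fun x => (exp (Re (f x)) * cos (Im (f x)))%R); [reflexivity|].
    replace (_ - _)%R with ((Re l * exp (Re (f t))) * cos (Im (f t))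
       + exp (Re (f t)) * (Im l * - sin (Im (f t))))%R by (unfold Re, Im; ring).
    apply (is_derive_Rmult (fun x => exp (Re (f x))) (fun x => cos (Im (f x)))).
    + apply (is_derive_comp exp (fun x => Re (f x))); [apply is_derive_exp | exact H1].
    + apply (is_derive_comp cos (fun x => Im (f x))); [apply is_derive_cos | exact H2].
  - replace (_ + _)%R with ((Re l * exp (Re (f t))) * sin (Im (f t))
       + exp (Re (f t)) * (Im l * cos (Im (f t))))%R by (unfold Re, Im; ring).
    apply (is_derive_Rmult (fun x => exp (Re (f x))) (fun x => sin (Im (f x)))).
    + apply (is_derive_comp exp (fun x => Re (f x))); [apply is_derive_exp | exact H1].
    + apply (is_derive_comp sin (fun x => Im (f x))); [apply is_derive_sin | exact H2].
Qed.

Lemma Cderive_scal (z : C) (t : R) : Cderive (fun x => RtoC x * z) t z.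
Proof.
  apply Cderive_eq with (1 * z + RtoC t * 0); [|ring].
  apply Cderive_mult; [apply Cderive_RtoC, @is_derive_id | apply Cderive_const].
Qed.

Lemma Cderive_pow (z : C) (t : R) (n : nat) :
  Cderive (fun x => (RtoC x * z) ^ S n) t (INR (S n) * z * (RtoC t * z) ^ n).
Proof.
  induction n as [|n IH].
  - apply Cderive_ext with (fun x => RtoC x * z); [intros; ring|].
    apply Cderive_eq with z; [apply Cderive_scal | simpl; ring].
  - apply Cderive_ext with (fun x => (RtoC x * z) * (RtoC x * z) ^ S n); [reflexivity|].
    eapply Cderive_eq; [apply Cderive_mult; [apply Cderive_scal | exact IH]|].
    rewrite (S_INR (S n)), RtoC_plus, !Cpow_S. ring.
Qed.

(** The real mean value inequality is applied to both coordinates, which costs the factor 2. The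
    interval is symmetric because [bounded_variation] asks for the whole ball around the starting
    point 0. *)
Lemma C_mean_value (f g : R -> C) (D : R) :
  (forall t : R, (Rabs t <= 1)%R -> Cderive f t (g t) /\ (Cmod (g t) <= D)%R) ->
  (Cmod (f 1%R - f 0%R) <= 2 * D)%R.
Proof.
  intros H.
  assert (aux : forall u : C -> R, (forall z, (Rabs (u z) <= Cmod z)%R) ->
     (forall t, (Rabs t <= 1)%R -> is_derive (fun x => u (f x)) t (u (g t))) ->
     (Rabs (u (f 1%R) - u (f 0%R)) <= D)%R).
  { intros u Hu Hd.
    replace D with (D * Rabs (1 - 0))%R by (rewrite Rminus_0_r, Rabs_R1; ring).
    apply (bounded_variation (fun x => u (f x)) (fun t => u (g t))).
    intros t Ht. rewrite !Rminus_0_r, Rabs_R1 in Ht.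
    split; [auto|]. eapply Rle_trans; [apply Hu | apply H, Ht]. }
  eapply Rle_trans; [apply Cmod_le_re_im|].
  assert (A := aux Re re_le_Cmod (fun t Ht => proj1 (proj1 (H t Ht)))).
  assert (B := aux Im im_le_Cmod (fun t Ht => proj2 (proj1 (H t Ht)))).
  change (Re (f 1%R - f 0%R)) with (Re (f 1%R) - Re (f 0%R))%R.
  change (Im (f 1%R - f 0%R)) with (Im (f 1%R) - Im (f 0%R))%R.
  lra.
Qed.

(** * The logarithm near 1 *)

(* [log (1 + z)] is the sum of [log_coef k * z ^ k]. *)
Definition log_coef (k : nat) : R :=
  match k with O => 0 | S m => (-1) ^ m / INR k end.

(** The bound on [z] keeps the real part of [1 + t z] at least 1/2 for all [t] between -1 and 1, so
    the arctangent of the slope is a smooth argument along the whole path. *)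
Lemma log_path (z : C) : (Cmod z <= 1 / 2)%R ->
  exists l : R -> C, l 0%R = 0 /\
    forall t, (Rabs t <= 1)%R -> 1 + RtoC t * z <> 0 /\ (1 / 2 <= Cmod (1 + RtoC t * z))%R /\
      Cderive l t (z / (1 + RtoC t * z)).
Proof.
  intros Hz. set (a := Re z); set (b := Im z).
  (* [l t] is the principal logarithm of [1 + t z]. *)
  exists (fun t => (ln ((1 + t * a) ^ 2 + (t * b) ^ 2) / 2, atan (t * b / (1 + t * a)))%R : C).
  split.
  - rewrite !Rmult_0_l. replace ((1 + 0) ^ 2 + 0 ^ 2)%R with 1%R by ring.
    rewrite ln_1. unfold Rdiv. rewrite !Rmult_0_l, atan_0. reflexivity.
  - intros t Ht.
    assert (Ha : (Rabs (t * a) <= 1 / 2)%R).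
    { rewrite Rabs_mult. apply Rle_trans with (1 * (1 / 2))%R; [|lra].
      apply Rmult_le_compat; try apply Rabs_pos; auto.
      eapply Rle_trans; [apply re_le_Cmod | exact Hz]. }
    apply Rabs_le_between in Ha.
    assert (Hre : Re (1 + RtoC t * z) = (1 + t * a)%R) by (unfold a, Re; simpl; ring).
    assert (Him : Im (1 + RtoC t * z) = (t * b)%R) by (unfold b, Im; simpl; ring).
    assert (Hmod : (1 / 2 <= Cmod (1 + RtoC t * z))%R).
    { eapply Rle_trans; [|apply re_le_Cmod]. rewrite Hre, Rabs_pos_eq; lra. }
    assert (Hne : 1 + RtoC t * z <> 0) by (apply Cmod_gt_0; lra).
    split; [exact Hne|]. split; [exact Hmod|].
    assert (H1 : (0 < 1 + t * a)%R) by lra.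
    assert (H2 : (0 < (1 + t * a) ^ 2 + (t * b) ^ 2)%R)
      by (assert (A := pow2_ge_0 (t * b)); assert (B := pow_lt _ 2 H1); lra).
    assert (H3 : (1 + t * a)%R <> 0%R) by lra.
    assert (H4 : ((1 + t * a) ^ 2 + (t * b) ^ 2)%R <> 0%R) by lra.
    unfold a, b in *; clear a b. destruct z as [x y].
    unfold Re, Im in *. cbn [fst snd] in *.
    split.
    + apply is_derive_ext with (fun t => (ln ((1 + t * x) ^ 2 + (t * y) ^ 2) / 2)%R); [reflexivity|].
      auto_derive; [simpl in *; lra|]. unfold Re; simpl in *. field. lra.
    + apply is_derive_ext with (fun t => (atan (t * y / (1 + t * x)))%R); [reflexivity|].
      auto_derive; [assumption|]. unfold Im; simpl in *. field. lra.
Qed.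

(** A finite geometric sum: the derivative of the truncated series differs from that of the
    logarithm by one explicit term, from which the remainder is estimated. *)
Lemma Cderive_log_poly (z : C) (t : R) (N : nat) : 1 + RtoC t * z <> 0 ->
  Cderive (fun x => Csum (fun k => log_coef k * (RtoC x * z) ^ k) N) t
    (z / (1 + RtoC t * z) - z / (1 + RtoC t * z) * (- (RtoC t * z)) ^ N).
Proof.
  intros Hne. induction N as [|N IH].
  - apply Cderive_ext with (fun _ => RtoC 0).
    { intros x; rewrite Csum_O; simpl; ring. }
    apply Cderive_eq with (RtoC 0); [apply Cderive_const | simpl; ring].
  - apply Cderive_ext with (fun x => Csum (fun k => log_coef k * (RtoC x * z) ^ k) N
        + log_coef (S N) * (RtoC x * z) ^ S N).
    { intros x; rewrite Csum_S; ring. }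
    eapply Cderive_eq.
    { apply Cderive_plus; [exact IH | apply Cderive_Cmult_l, Cderive_pow]. }
    assert (HN : RtoC (INR (S N)) <> 0).
    { intros H; apply RtoC_inj in H. revert H. apply not_0_INR; lia. }
    replace (RtoC (log_coef (S N))) with ((- (1)) ^ N / INR (S N)).
    2: { unfold log_coef. rewrite RtoC_div, RtoC_pow by (apply not_0_INR; lia).
         replace (RtoC (-1)) with (- (1)) by (apply C_eq; simpl; ring). reflexivity. }
    replace (- (RtoC t * z)) with (- (1) * (RtoC t * z)) by ring.
    rewrite !Cpow_mult_l, (Cpow_S (- (1))), (Cpow_S (RtoC t)), (Cpow_S z).
    field. auto.
Qed.

(** One logarithm [l] serves all [N]. In the constant 4, one factor 2 bounds the inverse of
    [1 + t z] and the other comes from [C_mean_value]. *)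
Lemma log_expansion (z : C) : (Cmod z <= 1 / 2)%R ->
  exists l : C, Cexp l = 1 + z /\
    forall N : nat, (Cmod (l - Csum (fun k => log_coef k * z ^ k)%C N) <= 4 * Cmod z ^ S N)%R.
Proof.
  intros Hz. destruct (log_path z Hz) as [l [H0 Hl]].
  exists (l 1%R). split.
  (* [Cexp (- l t) * (1 + t z)] has derivative 0, hence keeps the value 1 that it has at [t = 0]. *)
  - assert (H : (Cmod (Cexp (- (1) * l 1%R) * (1 + RtoC 1 * z)
                   - Cexp (- (1) * l 0%R) * (1 + RtoC 0 * z)) <= 2 * 0)%R).
    { apply (C_mean_value (fun t => Cexp (- (1) * l t) * (1 + RtoC t * z)) (fun _ => 0)).
      intros t Ht. destruct (Hl t Ht) as [Hne [_ Hd]].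
      split; [|rewrite Cmod_0; lra].
      eapply Cderive_eq.
      { apply Cderive_mult.
        - apply Cderive_Cexp, Cderive_Cmult_l, Hd.
        - apply Cderive_plus; [apply Cderive_const | apply Cderive_scal]. }
      cbv beta. field. exact Hne. }
    rewrite Rmult_0_r in H.
    assert (E := Cmod_eq_0 _ (Rle_antisym _ _ H (Cmod_ge_0 _))).
    rewrite H0 in E.
    replace (- (1) * 0) with (RtoC 0) in E by ring. rewrite Cexp_0 in E.
    replace (- (1) * l 1%R) with (- l 1%R) in E by ring. rewrite Cexp_opp in E.
    assert (E' : / Cexp (l 1%R) * (1 + z) = 1).
    { transitivity ((/ Cexp (l 1%R) * (1 + 1 * z) - 1 * (1 + 0 * z)) + 1); [ring|].
      rewrite E; ring. }
    transitivity (Cexp (l 1%R) * (/ Cexp (l 1%R) * (1 + z))).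
    + rewrite E'; ring.
    + field. apply Cexp_neq_0.
  - intros N.
    set (P := fun t : R => Csum (fun k => log_coef k * (RtoC t * z) ^ k) N).
    replace (l 1%R - Csum (fun k => log_coef k * z ^ k) N)
      with ((l 1%R + - (1) * P 1%R) - (l 0%R + - (1) * P 0%R)).
    2: { replace (P 0%R) with (RtoC 0).
         2: { symmetry. apply Csum_zero. intros k _. destruct k; simpl; ring. }
         replace (P 1%R) with (Csum (fun k => log_coef k * z ^ k) N).
         2: { apply Csum_ext; intros. rewrite Cmult_1_l; reflexivity. }
         rewrite H0. ring. }
    replace (4 * Cmod z ^ S N)%R with (2 * (2 * Cmod z ^ S N))%R by ring.
    apply (C_mean_value (fun t => l t + - (1) * P t)
      (fun t => z / (1 + RtoC t * z) * (- (RtoC t * z)) ^ N)).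
    intros t Ht. destruct (Hl t Ht) as [Hne [Hm Hd]]. split.
    + eapply Cderive_eq.
      { apply Cderive_plus; [exact Hd | apply Cderive_Cmult_l, Cderive_log_poly, Hne]. }
      ring.
    + rewrite Cmod_mult, Cmod_div, Cmod_pow, Cmod_opp, Cmod_mult, Cmod_R by exact Hne.
      assert (A : (/ Cmod (1 + RtoC t * z) <= 2)%R).
      { replace 2%R with (/ (1 / 2))%R by lra. apply Rinv_le_contravar; lra. }
      assert (B : ((Rabs t * Cmod z) ^ N <= Cmod z ^ N)%R).
      { apply pow_incr. assert (Z := Cmod_ge_0 z). assert (T := Rabs_pos t).
        split; [apply Rmult_le_pos; auto | nra]. }
      assert (Z := Cmod_ge_0 z).
      replace (2 * Cmod z ^ S N)%R with ((Cmod z * 2) * Cmod z ^ N)%R by (simpl; ring).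
      unfold Rdiv. apply Rmult_le_compat; auto.
      * apply Rmult_le_pos; [auto|]. left; apply Rinv_0_lt_compat; lra.
      * apply pow_le, Rmult_le_pos; [apply Rabs_pos | auto].
      * apply Rmult_le_compat_l; auto.
Qed.

(** * Convergence of products with ratios close to 1 *)

Lemma is_lim_seq_div_pow (M : R) (K : nat) : (1 <= K)%nat ->
  is_lim_seq (fun n => (M / INR n ^ K)%R) 0%R.
Proof.
  intros HK.
  apply is_lim_seq_0_abs_le with (v := fun n => (Rabs M * / INR n)%R).
  - exists 1%nat. intros n Hn.
    assert (H : (1 <= INR n)%R) by (apply (le_INR 1); lia).
    unfold Rdiv. rewrite Rabs_mult, Rabs_inv, (Rabs_pos_eq (INR n ^ K)) by (apply pow_le; lra).
    apply Rmult_le_compat_l; [apply Rabs_pos|].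
    apply Rinv_le_contravar; [lra|].
    rewrite <- (pow_1 (INR n)) at 1. apply Rle_pow; auto.
  - replace (Finite 0) with (Rbar_mult (Rabs M) 0) by (simpl; f_equal; ring).
    apply is_lim_seq_scal_l.
    apply (is_lim_seq_inv _ p_infty); [apply is_lim_seq_INR | discriminate].
Qed.

(** A discrete substitute for integrating [x^(-K-1)]. The constant [2^K] comes from
    [n + 1 <= 2 n]. *)
Lemma inv_pow_le_telescope (n K : nat) : (1 <= n)%nat -> (1 <= K)%nat ->
  (/ INR n ^ (K + 1) <= 2 ^ K * (/ INR n ^ K - / INR (S n) ^ K))%R.
Proof.
  intros Hn HK. destruct K as [|k]; [lia|].
  assert (H1 : (1 <= INR n)%R) by (apply (le_INR 1); lia).
  rewrite S_INR. set (x := INR n) in *.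
  assert (P0 : (0 < x ^ k)%R) by (apply pow_lt; lra).
  assert (P1 : (0 < (x + 1) ^ k)%R) by (apply pow_lt; lra).
  assert (P2 : (0 < 2 ^ k)%R) by (apply pow_lt; lra).
  assert (Q1 : (x ^ k <= (x + 1) ^ k)%R) by (apply pow_incr; lra).
  assert (Q2 : ((x + 1) ^ k <= 2 ^ k * x ^ k)%R).
  { rewrite <- Rpow_mult_distr. apply pow_incr; lra. }
  rewrite Nat.add_1_r. simpl.
  (* In the first reciprocal [x^k] is enlarged to [(x + 1)^k]; the difference then collapses to
     [1 / (x (x + 1) (x + 1)^k)]. *)
  apply Rle_trans with (2 * 2 ^ k * (/ (x * (x + 1) ^ k) - / ((x + 1) * (x + 1) ^ k)))%R.
  - replace (/ (x * (x + 1) ^ k) - / ((x + 1) * (x + 1) ^ k))%R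
      with (/ (x * (x + 1) * (x + 1) ^ k))%R by (field; lra).
    apply Rmult_le_reg_r with (x * (x * x ^ k) * ((x + 1) * (x + 1) ^ k))%R.
    { repeat apply Rmult_lt_0_compat; lra. }
    replace (/ (x * (x * x ^ k)) * (x * (x * x ^ k) * ((x + 1) * (x + 1) ^ k)))%R
      with ((x + 1) * (x + 1) ^ k)%R by (field; lra).
    replace (2 * 2 ^ k * / (x * (x + 1) * (x + 1) ^ k) * (x * (x * x ^ k) * ((x + 1) * (x + 1) ^ k)))%R
      with (2 * x * (2 ^ k * x ^ k))%R by (field; lra).
    apply Rmult_le_compat; lra.
  - apply Rmult_le_compat_l; [lra|].
    apply Rplus_le_reg_r with (/ ((x + 1) * (x + 1) ^ k))%R.
    ring_simplify.
    assert (R1 : (/ (x + 1) ^ k <= / x ^ k)%R) by (apply Rinv_le_contravar; lra).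
    assert (R2 : (0 < / x - / (x + 1))%R).
    { apply Rlt_0_minus. apply Rinv_lt_contravar; [nra | lra]. }
    rewrite !Rinv_mult.
    assert (0 < / x)%R by (apply Rinv_0_lt_compat; lra).
    apply Rmult_le_compat_l; lra.
Qed.

Lemma telescoping_bound (x : nat -> C) (n0 K : nat) (M : R) :
  (1 <= n0)%nat -> (1 <= K)%nat ->
  (forall n, (n0 <= n)%nat -> (Cmod (x (S n) - x n) <= M / INR n ^ (K + 1))%R) ->
  exists l, Clim x l /\
    forall n, (n0 <= n)%nat -> (Cmod (x n - l) <= 2 ^ K * M / INR n ^ K)%R.
Proof.
  intros Hn0 HK H.
  assert (HM : (0 <= M)%R).
  { assert (A := Rle_trans _ _ _ (Cmod_ge_0 _) (H n0 (Nat.le_refl _))).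
    assert (B : (0 < INR n0 ^ (K + 1))%R) by (apply pow_lt, (lt_INR 0); lia).
    apply Rmult_le_reg_r with (/ INR n0 ^ (K + 1))%R; [apply Rinv_0_lt_compat, B|].
    rewrite Rmult_0_l; exact A. }
  assert (P : forall n, (n0 <= n)%nat -> (0 < / INR n ^ K)%R)
    by (intros; apply Rinv_0_lt_compat, pow_lt, (lt_INR 0); lia).
  assert (H2 : (0 <= 2 ^ K * M)%R) by (apply Rmult_le_pos; [apply pow_le; lra | lra]).
  assert (D : forall n k, (n0 <= n)%nat ->
     (Cmod (x (n + k)%nat - x n) <= 2 ^ K * M * (/ INR n ^ K - / INR (n + k) ^ K))%R).
  { intros n k Hn; induction k as [|k IH].
    - rewrite Nat.add_0_r. replace (x n - x n) with (RtoC 0) by ring. rewrite Cmod_0. right; ring.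
    - rewrite Nat.add_succ_r.
      replace (x (S (n + k)) - x n) with ((x (S (n + k)) - x (n + k)%nat) + (x (n + k)%nat - x n))
        by ring.
      eapply Rle_trans; [apply Cmod_triangle|].
      assert (A := H (n + k)%nat ltac:(lia)).
      assert (B := inv_pow_le_telescope (n + k) K ltac:(lia) HK).
      apply (Rmult_le_compat_l M) in B; [|exact HM]. unfold Rdiv in A. lra. }
  assert (D' : forall n m, (n0 <= n)%nat -> (n <= m)%nat ->
     (Cmod (x m - x n) <= 2 ^ K * M / INR n ^ K)%R).
  { intros n m Hn Hm. replace m with (n + (m - n))%nat by lia.
    eapply Rle_trans; [apply D, Hn|]. unfold Rdiv. apply Rmult_le_compat_l; [exact H2|].
    assert (A := P (n + (m - n))%nat ltac:(lia)). lra. }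
  destruct (Clim_cauchy x (fun n => (2 ^ K * M / INR n ^ K)%R)) as [l Hl].
  { apply is_lim_seq_div_pow, HK. }
  { exists n0. intros n Hn m Hm. apply D'; auto. }
  exists l. split; [exact Hl|]. intros n Hn.
  apply Cmod_le_of_Clim with (x := fun m => x n - x m).
  - apply Clim_minus; [apply Clim_const | exact Hl].
  - exists n. intros m Hm. replace (x n - x m) with (- (x m - x n)) by ring.
    rewrite Cmod_opp. apply D'; auto.
Qed.

(** The exponents [e] are summed instead of taking logarithms of [F], so [F] may vanish: if [F n0]
    is 0, then so is [L], and the conclusion still holds. *)
Lemma product_asymptotic (F : nat -> C) (n0 K : nat) (M : R) :
  (1 <= n0)%nat -> (1 <= K)%nat ->
  (forall n, (n0 <= n)%nat ->
     exists e : C, F (S n) = F n * Cexp e /\ (Cmod e <= M / INR n ^ (K + 1))%R) ->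
  exists (L : C) (err : nat -> C),
    Clim F L /\ (F n0 <> 0 -> L <> 0) /\
    forall n, (n0 <= n)%nat ->
      F n = L * Cexp (err n) /\ (Cmod (err n) <= 2 ^ K * M / INR n ^ K)%R.
Proof.
  intros Hn0 HK H.
  set (e := fun n => epsilon (inhabits (RtoC 0)) (fun e : C =>
     F (S n) = F n * Cexp e /\ (Cmod e <= M / INR n ^ (K + 1))%R)).
  assert (He : forall n, (n0 <= n)%nat ->
     F (S n) = F n * Cexp (e n) /\ (Cmod (e n) <= M / INR n ^ (K + 1))%R).
  { intros n Hn. unfold e. apply epsilon_spec, H, Hn. }
  clearbody e. clear H.
  (* Below [n0] the values [e n] are arbitrary; only differences [s n - s n0] are used. *)
  set (s := fix s n := match n with O => RtoC 0 | S m => s m + e m end).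
  destruct (telescoping_bound s n0 K M Hn0 HK) as [l [Hl Hb]].
  { intros n Hn. simpl. replace (s n + e n - s n) with (e n) by ring. apply He, Hn. }
  assert (E : forall n, (n0 <= n)%nat -> F n = F n0 * Cexp (s n - s n0)).
  { intros n Hn. induction Hn as [|n Hn IH].
    - replace (s n0 - s n0) with (RtoC 0) by ring. rewrite Cexp_0; ring.
    - rewrite (proj1 (He n Hn)), IH. simpl.
      replace (s n + e n - s n0) with ((s n - s n0) + e n) by ring.
      rewrite (Cexp_plus (s n - s n0)). ring. }
  exists (F n0 * Cexp (l - s n0)), (fun n => s n - l).
  split; [|split; [|intros n Hn; split]].
  - apply Clim_ext_loc with (x := fun n => F n0 * Cexp (s n - s n0)).
    { exists n0. intros n Hn. symmetry; auto. }
    apply Clim_mult; [apply Clim_const|].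
    apply Clim_Cexp, Clim_minus; [exact Hl | apply Clim_const].
  - intros H. apply Cmult_neq_0; [exact H | apply Cexp_neq_0].
  - rewrite <- Cmult_assoc, <- Cexp_plus.
    replace (l - s n0 + (s n - l)) with (s n - s n0) by ring. auto.
  - auto.
Qed.

(** * Complex power series *)

Lemma Re_Csum (a : nat -> C) (n : nat) : Re (Csum a n) = sum_n (fun k => Re (a k)) n.
Proof.
  induction n as [|n IH]; [rewrite Csum_O, sum_O; reflexivity|].
  rewrite Csum_S, sum_Sn, <- IH. reflexivity.
Qed.

Lemma Im_Csum (a : nat -> C) (n : nat) : Im (Csum a n) = sum_n (fun k => Im (a k)) n.
Proof.
  induction n as [|n IH]; [rewrite Csum_O, sum_O; reflexivity|].
  rewrite Csum_S, sum_Sn, <- IH. reflexivity.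
Qed.

Lemma Clim_Csum (a : nat -> C) (l : C) :
  Clim (Csum a) l <-> is_series (fun n => Re (a n)) (Re l) /\ is_series (fun n => Im (a n)) (Im l).
Proof.
  split; intros [H1 H2]; split.
  - apply is_lim_seq_ext with (2 := H1). intros; apply Re_Csum.
  - apply is_lim_seq_ext with (2 := H2). intros; apply Im_Csum.
  - apply is_lim_seq_ext with (2 := H1). intros; symmetry; apply Re_Csum.
  - apply is_lim_seq_ext with (2 := H2). intros; symmetry; apply Im_Csum.
Qed.

(** A ball in [C_UniformSpace] is a product of two real balls, so both directions split into
    coordinates. *)
Lemma is_series_Clim (a : nat -> C) (l : C) :
  is_series (K := C_AbsRing) (V := C_NormedModule) a l <-> Clim (Csum a) l.
Proof.
  split.
  - intros H. split.
    + apply (filterlim_comp _ _ _ (Csum a) (fst : C -> R) _ _ _ H).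
      intros P [eps HP]; exists eps; intros y Hy. apply HP, Hy.
    + apply (filterlim_comp _ _ _ (Csum a) (snd : C -> R) _ _ _ H).
      intros P [eps HP]; exists eps; intros y Hy. apply HP, Hy.
  - intros [H1 H2]. apply (filterlim_locally (U := C_UniformSpace)). intros eps.
    apply (is_lim_seq_spec _ (Finite (Re l))) in H1.
    apply (is_lim_seq_spec _ (Finite (Im l))) in H2.
    destruct (H1 eps) as [N1 K1], (H2 eps) as [N2 K2].
    exists (max N1 N2). intros n Hn. split; [apply K1 | apply K2]; lia.
Qed.

Lemma ex_series_Rabs_Re (a : nat -> C) :
  ex_series (fun n => Cmod (a n)) -> ex_series (fun n => Rabs (Re (a n))).
Proof.
  intros H. apply (ex_series_le (V := R_CompleteNormedModule)) with (2 := H).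
  intros n. change norm with Rabs. rewrite Rabs_Rabsolu. apply re_le_Cmod.
Qed.

Lemma ex_series_Rabs_Im (a : nat -> C) :
  ex_series (fun n => Cmod (a n)) -> ex_series (fun n => Rabs (Im (a n))).
Proof.
  intros H. apply (ex_series_le (V := R_CompleteNormedModule)) with (2 := H).
  intros n. change norm with Rabs. rewrite Rabs_Rabsolu. apply im_le_Cmod.
Qed.

Definition conv (a b : nat -> C) (n : nat) : C := Csum (fun k => a k * b (n - k)%nat) n.

Lemma sum_n_f_R0 (a : nat -> R) (n : nat) : sum_n a n = sum_f_R0 a n.
Proof. apply sum_n_Reals. Qed.

Lemma Clim_cauchy_product (a b : nat -> C) (la lb : C) :
  ex_series (fun n => Cmod (a n)) -> ex_series (fun n => Cmod (b n)) ->
  Clim (Csum a) la -> Clim (Csum b) lb -> Clim (Csum (conv a b)) (la * lb).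
Proof.
  intros Ha Hb Hla Hlb.
  apply Clim_Csum in Hla, Hlb. destruct Hla as [A1 A2], Hlb as [B1 B2].
  assert (a1 := ex_series_Rabs_Re a Ha). assert (a2 := ex_series_Rabs_Im a Ha).
  assert (b1 := ex_series_Rabs_Re b Hb). assert (b2 := ex_series_Rabs_Im b Hb).
  apply Clim_Csum. split.
  - apply is_series_ext with (2 := is_series_minus _ _ _ _
      (is_series_mult _ _ _ _ A1 B1 a1 b1) (is_series_mult _ _ _ _ A2 B2 a2 b2)).
    intros n. unfold conv. rewrite Re_Csum, sum_n_f_R0.
    symmetry. exact (minus_sum (fun k => (Re (a k) * Re (b (n - k)%nat))%R)
      (fun k => (Im (a k) * Im (b (n - k)%nat))%R) n).
  - apply is_series_ext with (2 := is_series_plus _ _ _ _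
      (is_series_mult _ _ _ _ A1 B2 a1 b2) (is_series_mult _ _ _ _ A2 B1 a2 b1)).
    intros n. unfold conv. rewrite Im_Csum, sum_n_f_R0.
    symmetry. exact (plus_sum (fun k => (Re (a k) * Im (b (n - k)%nat))%R)
      (fun k => (Im (a k) * Re (b (n - k)%nat))%R) n).
Qed.

Lemma ex_series_Cmod_conv (a b : nat -> C) :
  ex_series (fun n => Cmod (a n)) -> ex_series (fun n => Cmod (b n)) ->
  ex_series (fun n => Cmod (conv a b n)).
Proof.
  intros [la Ha] [lb Hb].
  assert (aux : forall c : nat -> C, ex_series (fun n => Cmod (c n)) ->
     ex_series (fun n => Rabs (Cmod (c n)))).
  { intros c Hc. apply ex_series_ext with (2 := Hc).
    intros n. rewrite Rabs_pos_eq; [reflexivity | apply Cmod_ge_0]. }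
  apply (ex_series_le (V := R_CompleteNormedModule)) with
    (b := fun n => sum_f_R0 (fun k => Cmod (a k) * Cmod (b (n - k)%nat))%R n).
  - intros n. change norm with Rabs. rewrite Rabs_pos_eq by apply Cmod_ge_0.
    unfold conv. eapply Rle_trans; [apply Cmod_Csum|]. rewrite sum_n_f_R0. right.
    apply sum_eq. intros; apply Cmod_mult.
  - exists (la * lb)%R. apply (is_series_mult (fun n => Cmod (a n)) (fun n => Cmod (b n)));
      auto; apply aux; eexists; eassumption.
Qed.

Definition pterm (a : nat -> C) (z : C) (n : nat) : C := a n * z ^ n.

Lemma conv_pterm (a b : nat -> C) (z : C) (n : nat) :
  conv (pterm a z) (pterm b z) n = pterm (conv a b) z n.
Proof.
  unfold conv, pterm. rewrite Cmult_comm, <- Csum_mult_l.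
  apply Csum_ext. intros k Hk.
  replace (z ^ n) with (z ^ (k + (n - k))) by (f_equal; lia).
  rewrite Cpow_add_r. ring.
Qed.

Lemma real_pseries_unique (a : nat -> R) (r : R) : (0 < r)%R ->
  (forall x, x <> 0%R -> (Rabs x < r)%R -> is_series (fun n => (a n * x ^ n)%R) 0%R) ->
  forall n, a n = 0%R.
Proof.
  intros Hr H n.
  assert (Hps : forall x, x <> 0%R -> (Rabs x < r)%R -> is_pseries a x 0%R).
  { intros x Hx1 Hx2. apply is_pseries_R, H; auto. }
  assert (CV : Rbar_lt 0 (CV_radius a)).
  { apply Rbar_lt_le_trans with (Finite (r / 2)); [simpl; lra|].
    apply Rbar_not_lt_le. intros Hlt.
    assert (Habs : Rabs (r / 2) = (r / 2)%R) by (apply Rabs_pos_eq; lra).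
    rewrite <- Habs in Hlt. apply CV_disk_outside in Hlt. apply Hlt.
    apply ex_series_lim_0. exists 0%R. apply H; [lra | rewrite Habs; lra]. }
  (* Multiplication by [x] makes the identity true at [x = 0] too, where the hypothesis is silent.
     It shifts the coefficient to index [n + 1]. *)
  change (a n) with (PS_incr_1 a (S n)).
  change 0%R with ((fun _ : nat => 0%R) (S n)).
  apply PSeries_ext_recip.
  - rewrite CV_radius_incr_1. exact CV.
  - rewrite CV_radius_const_0. exact I.
  - exists (mkposreal r Hr). intros x Hx.
    rewrite PSeries_const_0, PSeries_incr_1.
    destruct (Req_dec x 0) as [->|Hx0]; [ring|].
    rewrite (is_pseries_unique a x 0%R); [ring|].
    apply Hps; [exact Hx0|]. change (Rabs (x - 0) < r)%R in Hx. rewrite Rminus_0_r in Hx. exact Hx.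
Qed.

(* The center 0 is left out of the hypothesis because [bernoulli_generating] leaves it out. *)
Lemma pseries_zero (a : nat -> C) (r : R) : (0 < r)%R ->
  (forall x : R, x <> 0%R -> (Rabs x < r)%R -> Clim (Csum (pterm a x)) 0) ->
  forall n, a n = 0.
Proof.
  intros Hr H n. apply C_eq.
  - apply real_pseries_unique with (a := fun n => Re (a n)) (1 := Hr).
    intros x Hx1 Hx2. specialize (H x Hx1 Hx2). apply Clim_Csum in H.
    apply is_series_ext with (2 := proj1 H).
    intros k. unfold pterm. rewrite <- RtoC_pow. apply re_scal_r.
  - apply real_pseries_unique with (a := fun n => Im (a n)) (1 := Hr).
    intros x Hx1 Hx2. specialize (H x Hx1 Hx2). apply Clim_Csum in H.
    apply is_series_ext with (2 := proj2 H).
    intros k. unfold pterm. rewrite <- RtoC_pow. apply im_scal_r.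
Qed.

Lemma pseries_unique (a b : nat -> C) (f : R -> C) (r : R) : (0 < r)%R ->
  (forall x : R, x <> 0%R -> (Rabs x < r)%R ->
     Clim (Csum (pterm a x)) (f x) /\ Clim (Csum (pterm b x)) (f x)) ->
  forall n, a n = b n.
Proof.
  intros Hr H n. apply Ceq_minus. apply (pseries_zero (fun n => a n - b n) r Hr).
  intros x Hx1 Hx2. destruct (H x Hx1 Hx2) as [Ha Hb].
  replace (RtoC 0) with (f x - f x) by ring.
  apply Clim_ext with (2 := Clim_minus _ _ _ _ Ha Hb).
  intros N. rewrite <- Csum_minus. apply Csum_ext. intros; unfold pterm; ring.
Qed.

(** * The power series of the complex exponential *)

Lemma INR_fact_neq_0_C (n : nat) : RtoC (INR (fact n)) <> 0.
Proof. intros H. apply RtoC_inj in H. exact (INR_fact_neq_0 n H). Qed.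

Lemma INR_S_neq_0_C (n : nat) : RtoC (INR (S n)) <> 0.
Proof. intros H. apply RtoC_inj in H. exact (not_0_INR (S n) (Nat.neq_succ_0 n) H). Qed.

Definition exp_coef (t : C) (n : nat) : C := t ^ n / INR (fact n).

Lemma Cmod_INR (n : nat) : Cmod (INR n) = INR n.
Proof. rewrite Cmod_R. apply Rabs_pos_eq, pos_INR. Qed.

Lemma ex_series_exp_coef (t z : C) : ex_series (fun n => Cmod (pterm (exp_coef t) z n)).
Proof.
  exists (exp (Cmod t * Cmod z)).
  assert (H := is_exp_Reals (Cmod t * Cmod z)). apply is_pseries_R in H.
  apply is_series_ext with (2 := H).
  intros n. unfold pterm, exp_coef.
  rewrite Cmod_mult, Cmod_div, !Cmod_pow, Cmod_INR by apply INR_fact_neq_0_C.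
  rewrite Rpow_mult_distr. match goal with |- @eq _ ?a ?b => change (@eq R a b) end. unfold Rdiv. ring.
Qed.

Lemma Cderive_exp_poly (z : C) (t : R) (N : nat) :
  Cderive (fun x => Csum (fun k => (RtoC x * z) ^ k / INR (fact k)) N) t
    (z * (Csum (fun k => (RtoC t * z) ^ k / INR (fact k)) N - (RtoC t * z) ^ N / INR (fact N))).
Proof.
  induction N as [|N IH].
  - apply Cderive_ext with (fun _ => RtoC 1).
    { intros x; rewrite Csum_O; simpl; field. }
    apply Cderive_eq with (RtoC 0); [apply Cderive_const|].
    rewrite Csum_O; simpl; field.
  - apply Cderive_ext with (fun x => Csum (fun k => (RtoC x * z) ^ k / INR (fact k)) N
        + / INR (fact (S N)) * (RtoC x * z) ^ S N).
    { intros x; rewrite Csum_S. unfold Cdiv. ring. }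
    eapply Cderive_eq.
    { apply Cderive_plus; [exact IH | apply Cderive_Cmult_l, Cderive_pow]. }
    rewrite Csum_S. rewrite fact_simpl, mult_INR, RtoC_mult.
    assert (A := INR_S_neq_0_C N). assert (B := INR_fact_neq_0_C N).
    field. auto.
Qed.

(** [Cexp] is defined through the real [exp], [cos] and [sin]; using its differential equation
    avoids recombining three real series. *)
Lemma Cexp_series (z : C) : Clim (Csum (fun k => z ^ k / INR (fact k))) (Cexp z).
Proof.
  set (E := fun N (t : R) => Csum (fun k => (RtoC t * z) ^ k / INR (fact k)) N).
  set (m := Cmod z).
  (* The derivative of [Cexp (- t z) * E N t] has only one term, the last one of the sum. *)
  assert (B : forall N, (Cmod (Cexp (- (1) * (RtoC 1 * z)) * E N 1%R
      - Cexp (- (1) * (RtoC 0 * z)) * E N 0%R) <= 2 * (m * exp m * (m ^ N / INR (fact N))))%R).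
  { intros N.
    apply (C_mean_value (fun t => Cexp (- (1) * (RtoC t * z)) * E N t)
      (fun t => - z * Cexp (- (1) * (RtoC t * z)) * ((RtoC t * z) ^ N / INR (fact N)))).
    intros t Ht. split.
    - eapply Cderive_eq.
      { apply Cderive_mult; [apply Cderive_Cexp, Cderive_Cmult_l, Cderive_scal | apply Cderive_exp_poly]. }
      cbv beta; fold (E N t). ring.
    - assert (Hz := Cmod_ge_0 z). fold m in Hz.
      assert (Htz : (Cmod (RtoC t * z) <= m)%R).
      { rewrite Cmod_mult, Cmod_R. fold m. assert (T := Rabs_pos t). nra. }
      rewrite !Cmod_mult, Cmod_div, Cmod_pow, Cmod_opp, Cmod_Cexp, Cmod_INR by apply INR_fact_neq_0_C.
      fold m.
      assert (F : (0 < INR (fact N))%R) by apply INR_fact_lt_0.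
      apply Rmult_le_compat.
      + apply Rmult_le_pos; [auto | left; apply exp_pos].
      + apply Rmult_le_pos; [apply pow_le, Cmod_ge_0 | left; apply Rinv_0_lt_compat, F].
      + apply Rmult_le_compat_l; [auto|].
        assert (L : (Re (- (1) * (RtoC t * z)) <= m)%R).
        { eapply Rle_trans; [apply Rle_abs|]. eapply Rle_trans; [apply re_le_Cmod|].
          rewrite Cmod_mult, Cmod_m1, Rmult_1_l. exact Htz. }
        destruct L as [L|L]; [left; apply exp_increasing, L | rewrite L; apply Rle_refl].
      + apply Rmult_le_compat_r; [left; apply Rinv_0_lt_compat, F|].
        apply pow_incr. split; [apply Cmod_ge_0 | exact Htz]. }
  apply Clim_Cmod_le with
    (v := fun N => (Cmod (Cexp z) * (2 * (m * exp m)) * (m ^ N / INR (fact N)))%R).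
  - exists O. intros N _. specialize (B N).
    replace (E N 0%R) with (RtoC 1) in B.
    2: { unfold E. rewrite (Csum_single _ 0); [simpl; field | lia |].
         intros i _ Hi. destruct i as [|i]; [lia|]. simpl. unfold Cdiv. ring. }
    replace (- (1) * (RtoC 0 * z)) with (RtoC 0) in B by ring. rewrite Cexp_0 in B.
    replace (- (1) * (RtoC 1 * z)) with (- z) in B by ring. rewrite Cexp_opp in B.
    replace (Csum (fun k => z ^ k / INR (fact k)) N) with (E N 1%R).
    2: { apply Csum_ext. intros; rewrite Cmult_1_l; reflexivity. }
    replace (E N 1%R - Cexp z) with (Cexp z * (/ Cexp z * E N 1%R - 1 * 1))
      by (field; apply Cexp_neq_0).
    rewrite Cmod_mult. rewrite !Rmult_assoc.
    apply Rmult_le_compat_l; [apply Cmod_ge_0|]. rewrite <- Rmult_assoc in B |- *.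
    eapply Rle_trans; [exact B|]. right; ring.
  - replace (Finite 0) with (Rbar_mult (Cmod (Cexp z) * (2 * (m * exp m)))%R 0)
      by (simpl; f_equal; ring).
    apply is_lim_seq_scal_l. apply is_lim_seq_Reals, cv_speed_pow_fact.
Qed.

Lemma Cexp_pseries (t z : C) : Clim (Csum (pterm (exp_coef t) z)) (Cexp (t * z)).
Proof.
  apply Clim_ext with (2 := Cexp_series (t * z)).
  intros N. apply Csum_ext. intros k _. unfold pterm, exp_coef. rewrite Cpow_mult_l.
  unfold Cdiv. ring.
Qed.

(** * Bernoulli polynomials *)

(* Table of the numbers [B_k / k!] up to index [m]; entries beyond [m] are junk. *)
Fixpoint bern_table (m : nat) : nat -> R :=
  match m with
  | O => fun _ => 1
  | S p => fun k => if Nat.leb k p then bern_table p k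
      else (- sum_n (fun j => bern_table p j / INR (fact (S p + 1 - j))) p)%R
  end.

Definition bern_coef (k : nat) : R := bern_table k k.

Lemma bern_table_stable (m k : nat) : (k <= m)%nat -> bern_table m k = bern_coef k.
Proof.
  intros H; induction H as [|m Hm IH]; [reflexivity|].
  simpl. destruct (Nat.leb_spec k m); [exact IH | lia].
Qed.

Lemma bern_coef_S (p : nat) :
  bern_coef (S p) = (- sum_n (fun j => bern_coef j / INR (fact (S p + 1 - j))) p)%R.
Proof.
  unfold bern_coef at 1. cbn [bern_table].
  destruct (Nat.leb_spec (S p) p); [lia|]. f_equal.
  apply sum_n_ext_loc. intros j Hj. rewrite bern_table_stable by exact Hj. reflexivity.
Qed.

Lemma pow2_le_fact (i : nat) : (2 ^ i <= INR (fact (S i)))%R.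
Proof.
  induction i as [|i IH]; [simpl; lra|].
  rewrite fact_simpl, mult_INR. simpl (2 ^ S i)%R.
  apply Rmult_le_compat; [lra | apply pow_le; lra | | exact IH].
  apply (le_INR 2); lia.
Qed.

Lemma Rabs_sum_n (a : nat -> R) (n : nat) :
  (Rabs (sum_n a n) <= sum_n (fun k => Rabs (a k)) n)%R.
Proof.
  rewrite !sum_n_f_R0. apply Rsum_abs.
Qed.

(** Since [(i+1)! >= 2^i], the recurrence and the induction hypothesis bound the value by the sum of
    [2^(-i)] over [1 <= i <= p + 1], which is below 1. The resulting radius of convergence 1 is far
    from the true [2 pi], but [bernoulli_generating] asks only for some positive radius. *)
Lemma bern_coef_le_1 (m : nat) : (Rabs (bern_coef m) <= 1)%R.
Proof.
  induction m as [m IH] using lt_wf_ind. destruct m as [|p].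
  - unfold bern_coef; simpl. rewrite Rabs_R1; lra.
  - rewrite bern_coef_S, Rabs_Ropp.
    eapply Rle_trans; [apply Rabs_sum_n|].
    apply Rle_trans with (sum_n (fun j => (/ 2 ^ S p * 2 ^ j)%R) p).
    + rewrite !sum_n_f_R0. apply sum_Rle. intros j Hj.
      unfold Rdiv. rewrite Rabs_mult, Rabs_inv, (Rabs_pos_eq (INR _)) by apply pos_INR.
      replace (/ 2 ^ S p * 2 ^ j)%R with (/ 2 ^ (S p - j))%R.
      2: { replace (2 ^ S p)%R with (2 ^ (S p - j) * 2 ^ j)%R
             by (rewrite <- pow_add; f_equal; lia).
           field. split; apply pow_nonzero; lra. }
      rewrite <- (Rmult_1_l (/ 2 ^ (S p - j))%R).
      apply Rmult_le_compat; [apply Rabs_pos | left; apply Rinv_0_lt_compat, INR_fact_lt_0 | apply IH; lia |].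
      apply Rinv_le_contravar; [apply pow_lt; lra|].
      replace (S p + 1 - j)%nat with (S (S p - j)) by lia. apply pow2_le_fact.
    + replace (sum_n (fun j => (/ 2 ^ S p * 2 ^ j)%R) p) with (1 - / 2 ^ S p)%R.
      { assert (A : (0 < / 2 ^ S p)%R) by (apply Rinv_0_lt_compat, pow_lt; lra). lra. }
      rewrite (sum_n_mult_l (K := R_Ring)), sum_n_f_R0, tech3 by lra.
      change mult with Rmult.
      assert (A : (2 ^ S p)%R <> 0%R) by (apply pow_nonzero; lra).
      field_simplify; [|lra|exact A]. field. exact A.
Qed.

(* [(e^z - 1) / z] is the sum of [todd_coef n * z ^ n]. *)
Definition todd_coef (n : nat) : C := / INR (fact (S n)).

(** The recurrence defining [bern_coef], read as the coefficients of
    [z/(e^z - 1) * (e^z - 1)/z = 1]. *)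
Lemma conv_bern_todd (n : nat) :
  conv (fun k => RtoC (bern_coef k)) todd_coef n = if Nat.eqb n 0 then 1 else 0.
Proof.
  unfold conv. destruct n as [|p].
  - rewrite Csum_O. unfold todd_coef, bern_coef; simpl. field.
  - rewrite Csum_S, bern_coef_S.
    replace (S p - S p)%nat with O by lia. unfold todd_coef at 2. simpl (fact 1).
    replace (RtoC (INR 1)) with (RtoC 1) by reflexivity.
    apply C_eq.
    + rewrite re_plus, Re_Csum. simpl Nat.eqb. cbv iota.
      replace (sum_n (fun k => Re (bern_coef k * todd_coef (S p - k))) p)
        with (sum_n (fun j => bern_coef j / INR (fact (S p + 1 - j)))%R p).
      { simpl. field. }
      apply sum_n_ext_loc. intros j Hj. unfold todd_coef.
      replace (S (S p - j)) with (S p + 1 - j)%nat by lia.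
      rewrite <- RtoC_inv, re_scal_l by apply INR_fact_neq_0. reflexivity.
    + rewrite im_plus, Im_Csum.
      rewrite (sum_n_ext_loc _ (fun _ => 0%R)).
      { rewrite sum_n_const. simpl. field. }
      intros j Hj. unfold todd_coef.
      rewrite <- RtoC_inv, im_scal_l by apply INR_fact_neq_0. apply Rmult_0_r.
Qed.

Lemma ex_series_bern_coef (z : C) : (Cmod z < 1)%R ->
  ex_series (fun n => Cmod (pterm (fun k => RtoC (bern_coef k)) z n)).
Proof.
  intros Hz. assert (Z := Cmod_ge_0 z).
  apply (ex_series_le (V := R_CompleteNormedModule)) with (b := fun n => (Cmod z ^ n)%R).
  - intros n. change norm with Rabs. rewrite Rabs_pos_eq by apply Cmod_ge_0.
    unfold pterm. rewrite Cmod_mult, Cmod_pow, Cmod_R.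
    rewrite <- (Rmult_1_l (Cmod z ^ n)) at 2.
    apply Rmult_le_compat_r; [apply pow_le, Z | apply bern_coef_le_1].
  - exists (/ (1 - Cmod z))%R. apply is_series_geom. rewrite Rabs_pos_eq; auto.
Qed.

Lemma ex_series_todd (z : C) : ex_series (fun n => Cmod (pterm todd_coef z n)).
Proof.
  destruct (Ceq_dec z 0) as [->|Hz].
  - exists 1%R. apply is_series_ext with (a := fun n => if Nat.eqb n 0 then 1%R else 0%R).
    + intros [|n]; unfold pterm, todd_coef.
      * simpl. rewrite Cmult_1_r, Cmod_inv, Cmod_1 by (intros H; apply RtoC_inj in H; lra).
        rewrite Rinv_1. reflexivity.
      * simpl (Nat.eqb _ _). cbv iota.
        replace (RtoC 0 ^ S n) with (RtoC 0) by (simpl; ring). rewrite Cmult_0_r, Cmod_0. reflexivity.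
    + apply (is_lim_seq_ext (fun _ => 1%R) _ (Finite 1)); [|apply is_lim_seq_const].
      intros n. induction n as [|n IH]; [rewrite sum_O; reflexivity|].
      rewrite sum_Sn, <- IH. simpl. symmetry. apply Rplus_0_r.
  - assert (H := ex_series_exp_coef 1 z).
    apply ex_series_incr_1 in H.
    apply (ex_series_scal (/ Cmod z)%R) in H.
    apply ex_series_ext with (2 := H). intros n.
    change scal with Rmult. unfold pterm, exp_coef, todd_coef.
    rewrite Cpow_1_l, Cpow_S. unfold Cdiv. rewrite !Cmod_mult, Cmod_1.
    match goal with |- @eq _ ?a ?b => change (@eq R a b) end.
    field. apply Cmod_gt_0 in Hz. lra.
Qed.

Lemma todd_series (z : C) : z <> 0 -> Clim (Csum (pterm todd_coef z)) ((Cexp z - 1) / z).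
Proof.
  intros Hz. assert (H := Cexp_pseries 1 z). rewrite Cmult_1_l in H.
  apply (Clim_incr_n _ 1) in H.
  assert (H' := Clim_mult _ _ _ _ (Clim_minus _ _ _ _ H (Clim_const 1)) (Clim_const (/ z))).
  apply Clim_ext with (2 := H').
  intros n. rewrite Nat.add_1_r.
  replace (Csum (pterm (exp_coef 1) z) (S n)) with (1 + z * Csum (pterm todd_coef z) n).
  - field. exact Hz.
  - rewrite <- Csum_mult_l. induction n as [|n IH].
    + rewrite Csum_S, !Csum_O. unfold pterm, exp_coef, todd_coef. simpl. field.
    + rewrite Csum_S, (Csum_S _ (S n)), <- IH.
      unfold pterm at 2 4, exp_coef, todd_coef. rewrite Cpow_1_l, (Cpow_S z (S n)).
      field. apply INR_fact_neq_0_C.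
Qed.

(** The Cauchy product gives [A * ((e^z - 1)/z) = 1] for the sum [A], so the nonvanishing of
    [e^z - 1] comes out together with the value of [A] and the zeros of [e^z - 1] need not be
    located. *)
Lemma bern_coef_series (z : C) : z <> 0 -> (Cmod z < 1)%R ->
  Cexp z - 1 <> 0 /\ Clim (Csum (pterm (fun k => RtoC (bern_coef k)) z)) (z / (Cexp z - 1)).
Proof.
  intros Hz Hz1.
  assert (HA : exists A, Clim (Csum (pterm (fun k => RtoC (bern_coef k)) z)) A).
  { destruct (ex_series_Rabs _ (ex_series_Rabs_Re _ (ex_series_bern_coef z Hz1))) as [a Ha].
    destruct (ex_series_Rabs _ (ex_series_Rabs_Im _ (ex_series_bern_coef z Hz1))) as [b Hb].
    exists (a, b). apply Clim_Csum. split; assumption. }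
  destruct HA as [A HA].
  assert (P : A * ((Cexp z - 1) / z) = 1).
  { apply Clim_unique with (x := Csum (conv (pterm (fun k => RtoC (bern_coef k)) z) (pterm todd_coef z))).
    - apply Clim_cauchy_product; auto using ex_series_bern_coef, ex_series_todd, todd_series.
    - apply Clim_ext with (fun _ => RtoC 1); [|apply Clim_const].
      intros n. rewrite (Csum_single _ 0); [|lia|].
      + rewrite conv_pterm. unfold pterm. rewrite conv_bern_todd. simpl. ring.
      + intros i _ Hi. rewrite conv_pterm. unfold pterm. rewrite conv_bern_todd.
        destruct i; [lia|]. simpl. ring. }
  assert (Hne : Cexp z - 1 <> 0).
  { intros H. rewrite H in P. unfold Cdiv in P. rewrite Cmult_0_l, Cmult_0_r in P.
    apply RtoC_inj in P. lra. }
  split; [exact Hne|].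
  replace (z / (Cexp z - 1)) with A; [exact HA|].
  transitivity (A * ((Cexp z - 1) / z) * (z / (Cexp z - 1))); [field; auto|].
  rewrite P. ring.
Qed.

Definition bern_poly_coef (t : C) : nat -> C := conv (fun k => RtoC (bern_coef k)) (exp_coef t).

Lemma bern_poly_series (t z : C) : z <> 0 -> (Cmod z < 1)%R ->
  Clim (Csum (pterm (bern_poly_coef t) z)) (z * Cexp (t * z) / (Cexp z - 1)).
Proof.
  intros Hz Hz1. destruct (bern_coef_series z Hz Hz1) as [Hne HA].
  replace (z * Cexp (t * z) / (Cexp z - 1)) with (z / (Cexp z - 1) * Cexp (t * z))
    by (field; exact Hne).
  apply Clim_ext with (Csum (conv (pterm (fun k => RtoC (bern_coef k)) z) (pterm (exp_coef t) z))).
  { intros n. apply Csum_ext. intros; apply conv_pterm. }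
  apply Clim_cauchy_product; auto using ex_series_bern_coef, ex_series_exp_coef, Cexp_pseries.
Qed.

(** [epsilon] says nothing until a witness exists; here it is [n!] times the Cauchy product of
    [z/(e^z - 1)] and [e^(tz)]. *)
Lemma bernoulli_poly_spec : bernoulli_generating bernoulli_poly.
Proof.
  unfold bernoulli_poly. apply epsilon_spec.
  exists (fun n t => INR (fact n) * bern_poly_coef t n).
  intros t. exists 1%R. split; [lra|]. intros z Hz Hz1.
  apply is_series_Clim. apply Clim_ext with (2 := bern_poly_series t z Hz Hz1).
  intros n. apply Csum_ext. intros k _. unfold pterm. field. apply INR_fact_neq_0_C.
Qed.

(** The chosen family and the constructed one have the same sum on a common punctured neighbourhood
    of 0, hence the same coefficients. *)
Lemma bernoulli_poly_eq (n : nat) (t : C) :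
  bernoulli_poly n t = INR (fact n) * bern_poly_coef t n.
Proof.
  destruct (bernoulli_poly_spec t) as [r [Hr H]].
  assert (E : bernoulli_poly n t / INR (fact n) = bern_poly_coef t n).
  { apply (pseries_unique (fun n => bernoulli_poly n t / INR (fact n)) (bern_poly_coef t)
      (fun x => x * Cexp (t * x) / (Cexp x - 1)) (Rmin r 1)).
    - apply Rmin_pos; lra.
    - intros x Hx Hxr.
      assert (Hx0 : RtoC x <> 0) by (intros E; apply RtoC_inj in E; auto).
      assert (Hm : (Cmod x < Rmin r 1)%R) by (rewrite Cmod_R; exact Hxr).
      split.
      + apply Clim_ext with (2 := proj1 (is_series_Clim _ _)
          (H x Hx0 (Rlt_le_trans _ _ _ Hm (Rmin_l _ _)))).
        intros N. apply Csum_ext. intros k _. unfold pterm. field. apply INR_fact_neq_0_C.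
      + apply bern_poly_series; [exact Hx0 | exact (Rlt_le_trans _ _ _ Hm (Rmin_r _ _))]. }
  rewrite <- E. field. apply INR_fact_neq_0_C.
Qed.

(** The Bernoulli recurrence divided by [(n+1)!]. Comparing the sums as functions replaces a
    rearrangement of the triple convolution. *)
Lemma conv_bern_poly_todd (t : C) (n : nat) : conv (bern_poly_coef t) todd_coef n = exp_coef t n.
Proof.
  apply (pseries_unique (conv (bern_poly_coef t) todd_coef) (exp_coef t) (fun x => Cexp (t * x)) 1);
    [lra|].
  intros x Hx Hx1.
  assert (Hx0 : RtoC x <> 0) by (intros E; apply RtoC_inj in E; auto).
  assert (Hm : (Cmod x < 1)%R) by (rewrite Cmod_R; exact Hx1).
  split; [|apply Cexp_pseries].
  apply Clim_ext with (Csum (conv (pterm (bern_poly_coef t) x) (pterm todd_coef x))).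
  { intros N. apply Csum_ext. intros; apply conv_pterm. }
  replace (Cexp (t * x)) with (x * Cexp (t * x) / (Cexp x - 1) * ((Cexp x - 1) / x)).
  2: { field. split; [exact Hx0 | apply (bern_coef_series x Hx0 Hm)]. }
  apply Clim_cauchy_product; auto using ex_series_todd, todd_series, bern_poly_series.
  apply ex_series_ext with (fun n =>
    Cmod (conv (pterm (fun k => RtoC (bern_coef k)) x) (pterm (exp_coef t) x) n)).
  { intros k. rewrite conv_pterm. reflexivity. }
  apply ex_series_Cmod_conv; auto using ex_series_bern_coef, ex_series_exp_coef.
Qed.

Lemma bernoulli_eq (n : nat) : bernoulli n = INR (fact n) * bern_coef n.
Proof.
  unfold bernoulli. rewrite bernoulli_poly_eq. f_equal.
  unfold bern_poly_coef, conv. rewrite (Csum_single _ n); [|lia|].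
  - rewrite Nat.sub_diag. unfold exp_coef; simpl. field.
  - intros i Hi Hne. unfold exp_coef. destruct (n - i)%nat eqn:E; [lia|].
    simpl. unfold Cdiv. ring.
Qed.

(** [(-x)/(e^(-x) - 1) = x/(e^x - 1) + x], so changing the sign of [x] alters the coefficient of
    degree 1 alone. *)
Lemma bern_coef_parity (n : nat) : n <> 1%nat -> (- (1)) ^ n * bern_coef n = bern_coef n.
Proof.
  intros Hn.
  assert (H : (- (1)) ^ n * bern_coef n = bern_coef n + (if Nat.eqb n 1 then 1 else 0)).
  { apply (pseries_unique (fun n => (- (1)) ^ n * bern_coef n)
      (fun n => bern_coef n + (if Nat.eqb n 1 then 1 else 0))
      (fun x => (- x) / (Cexp (- x) - 1)) 1); [lra|].
    intros x Hx Hx1.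
    assert (Hx0 : RtoC x <> 0) by (intros E; apply RtoC_inj in E; auto).
    assert (Hm : (Cmod x < 1)%R) by (rewrite Cmod_R; exact Hx1).
    assert (Hx0' : - RtoC x <> 0).
    { intros E. apply Hx0. transitivity (- - RtoC x); [ring | rewrite E; ring]. }
    assert (Hm' : (Cmod (- x) < 1)%R) by (rewrite Cmod_opp; exact Hm).
    destruct (bern_coef_series x Hx0 Hm) as [Hne HA].
    destruct (bern_coef_series (- x) Hx0' Hm') as [Hne' HA'].
    split.
    - apply Clim_ext with (2 := HA'). intros N. apply Csum_ext. intros k _. unfold pterm.
      replace (- RtoC x) with (- (1) * RtoC x) by ring. rewrite Cpow_mult_l. ring.
    - replace (- RtoC x / (Cexp (- x) - 1)) with (x / (Cexp x - 1) + x).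
      2: { rewrite Cexp_opp in Hne' |- *. field. repeat split; auto using Cexp_neq_0.
           intros E. apply Hne. transitivity (- (1 - Cexp x)); [ring|]. rewrite E. ring. }
      apply Clim_ext_loc with (2 := Clim_plus _ _ _ _ HA (Clim_const x)).
      exists 1%nat. intros N HN.
      replace (RtoC x) with (Csum (fun k => if Nat.eqb k 1 then RtoC x else 0) N) at 2.
      2: { rewrite (Csum_single _ 1); [reflexivity | exact HN |].
           intros i _ Hi. destruct (Nat.eqb_spec i 1); [lia | reflexivity]. }
      rewrite <- Csum_plus. apply Csum_ext. intros k _. unfold pterm.
      destruct (Nat.eqb_spec k 1) as [->|_]; [simpl; ring | ring]. }
  destruct (Nat.eqb_spec n 1); [lia|]. rewrite Cplus_0_r in H. exact H.
Qed.

(** * Expansion of the increments of the exponent *)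

(* [y^j (1 + y)^(-j)] is the sum of [shift_coef j m * y^m]. With [y = 1/n] this is [(n + 1)^(-j)]. *)
Fixpoint shift_coef (j m : nat) : R :=
  match m with
  | O => if Nat.eqb j 0 then 1 else 0
  | S k => match j with
           | O => 0
           | S i => shift_coef i k - shift_coef j k
           end
  end.

Lemma shift_coef_SS (j m : nat) :
  shift_coef (S j) (S m) = (shift_coef j m - shift_coef (S j) m)%R.
Proof. reflexivity. Qed.

(** The truncation at degree [M] of [(1 + y) g_(j+1) = y g_j], where [g_j = (y/(1 + y))^j]; the last
    term is the overshoot in degree [M + 1]. *)
Lemma shift_coef_recurrence (y : R) (j M : nat) :
  ((1 + y) * sum_n (fun m => shift_coef (S j) m * y ^ m) M =
   y * sum_n (fun m => shift_coef j m * y ^ m) M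
   + (shift_coef (S j) M - shift_coef j M) * y ^ S M)%R.
Proof.
  rewrite !sum_n_f_R0.
  induction M as [|M IH]; [simpl; ring|].
  cbn [sum_f_R0]. rewrite Rmult_plus_distr_l, IH.
  cbn [shift_coef pow]. ring.
Qed.

(** Dividing the recurrence by [1 + y] multiplies the previous error by [y/(1 + y) <= 1] and adds at
    most the overshoot. Thus one constant [D] serves all [y >= 0]. *)
Lemma shift_expansion (j M : nat) :
  exists D : R, (0 <= D)%R /\ forall y : R, (0 <= y)%R ->
    (Rabs ((y / (1 + y)) ^ j - sum_n (fun m => shift_coef j m * y ^ m) M) <= D * y ^ S M)%R.
Proof.
  induction j as [|j [D [HD IH]]].
  - exists 0%R. split; [lra|]. intros y Hy.
    replace (sum_n _ M) with 1%R.
    { simpl. rewrite Rminus_diag, Rabs_R0. lra. }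
    rewrite sum_n_f_R0. induction M as [|M IH]; [simpl; ring|].
    cbn [sum_f_R0 shift_coef]. rewrite <- IH. ring.
  - exists (D + Rabs (shift_coef (S j) M - shift_coef j M))%R.
    split; [assert (A := Rabs_pos (shift_coef (S j) M - shift_coef j M)); lra|].
    intros y Hy.
    assert (R := shift_coef_recurrence y j M). specialize (IH y Hy).
    set (T' := sum_n (fun m => (shift_coef (S j) m * y ^ m)%R) M) in *.
    set (T := sum_n (fun m => (shift_coef j m * y ^ m)%R) M) in *.
    set (d := (shift_coef (S j) M - shift_coef j M)%R) in *.
    assert (HyM : (0 <= y ^ S M)%R) by (apply pow_le; exact Hy).
    replace ((y / (1 + y)) ^ S j - T')%R
      with ((y / (1 + y)) * ((y / (1 + y)) ^ j - T) + (- / (1 + y)) * (d * y ^ S M))%R.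
    2: { replace T' with ((y * T + d * y ^ S M) / (1 + y))%R by (rewrite <- R; field; lra).
         simpl. field. lra. }
    assert (A : (0 <= y / (1 + y) <= 1)%R).
    { split; [apply Rdiv_le_0_compat; lra|]. apply Rmult_le_reg_r with (1 + y)%R; [lra|].
      unfold Rdiv. rewrite Rmult_assoc, Rinv_l by lra. lra. }
    assert (B : (0 <= / (1 + y) <= 1)%R).
    { split; [left; apply Rinv_0_lt_compat; lra|]. rewrite <- Rinv_1. apply Rinv_le_contravar; lra. }
    eapply Rle_trans; [apply Rabs_triang|].
    rewrite !Rabs_mult, Rabs_Ropp, (Rabs_pos_eq (y / (1 + y))), (Rabs_pos_eq (/ (1 + y))),
      (Rabs_pos_eq (y ^ S M)) by lra.
    rewrite Rmult_plus_distr_r. apply Rplus_le_compat.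
    + rewrite <- (Rmult_1_l (D * _)). apply Rmult_le_compat; [lra | apply Rabs_pos | lra | exact IH].
    + rewrite <- (Rmult_1_l (Rabs d * y ^ S M)) at 2. apply Rmult_le_compat_r; [|lra].
      apply Rmult_le_pos; [apply Rabs_pos | exact HyM].
Qed.

Lemma shift_coef_lt (j m : nat) : (m < j)%nat -> shift_coef j m = 0%R.
Proof.
  revert j; induction m as [|m IH]; intros j H; destruct j as [|j]; try lia; simpl; [reflexivity|].
  rewrite !IH by lia. ring.
Qed.

Lemma shift_coef_diag (j : nat) : shift_coef j j = 1%R.
Proof.
  induction j as [|j IH]; [reflexivity|].
  simpl. rewrite IH, shift_coef_lt by lia. ring.
Qed.

(** Up to the sign this is binomial(i + k, k), from the binomial series of [(1 + y)^(-i-1)]; the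
    double induction is Pascal's rule. The factorials are there to cancel those of [exponent_coef]
    and to leave [todd_coef]. *)
Lemma shift_coef_fact (i k : nat) :
  shift_coef (S i) (S i + k) =
  ((-1) ^ k * INR (fact (i + k)) / (INR (fact i) * INR (fact k)))%R.
Proof.
  revert k; induction i as [|i IHi]; intros k; induction k as [|k IHk].
  - simpl. field.
  - change (shift_coef 1 (1 + S k)) with (0 - shift_coef 1 (1 + k))%R. rewrite IHk.
    simpl (0 + _)%nat.
    assert (A := INR_fact_neq_0 k). assert (B := INR_fact_neq_0 (S k)).
    simpl (fact 0). simpl ((-1) ^ S k)%R. simpl (INR 1). field. auto.
  - rewrite !Nat.add_0_r, shift_coef_diag. simpl (fact 0). simpl.
    assert (A := INR_fact_neq_0 (S i)). simpl in A. field. exact A.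
  - replace (S (S i) + S k)%nat with (S (S (S i) + k)) by lia.
    rewrite shift_coef_SS, IHk.
    replace (S (S i) + k)%nat with (S i + S k)%nat by lia. rewrite IHi.
    replace (i + S k)%nat with (S (i + k)) by lia.
    replace (S i + S k)%nat with (S (S (i + k))) by lia.
    replace (S i + k)%nat with (S (i + k)) by lia.
    rewrite (fact_simpl (S (i + k))), (fact_simpl i), (fact_simpl k), !mult_INR, !S_INR, plus_INR.
    assert (A := INR_fact_neq_0 i). assert (B := INR_fact_neq_0 k).
    assert (P := pos_INR i). assert (Q := pos_INR k).
    simpl ((-1) ^ S k)%R. field. repeat split; try lra.
Qed.

Lemma Csum_shift (f : nat -> C) (n : nat) : Csum f (S n) = f O + Csum (fun k => f (S k)) n.
Proof.
  induction n as [|n IH]; [rewrite Csum_S, !Csum_O; reflexivity|].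
  rewrite Csum_S, IH, (Csum_S _ n). ring.
Qed.

Lemma Csum_truncate (f : nat -> C) (r n : nat) : (r <= n)%nat ->
  (forall k, (r < k <= n)%nat -> f k = 0) -> Csum f n = Csum f r.
Proof.
  intros Hr; induction Hr as [|n Hr IH]; intros H; [reflexivity|].
  rewrite Csum_S, IH, H by (intros; try apply H; lia). ring.
Qed.

(** The coefficients of [z (e^(uz) + e^(vz) - 2) / (e^z - 1)]. *)
Definition bern_diff (u v : C) (k : nat) : C :=
  bern_poly_coef u k + bern_poly_coef v k - 2 * bern_poly_coef 0 k.

(* This is [W_coef p q Delta j] for [j >= 1], where [u, v = (p +- Delta) / 2]; the sign in
   front of [bern_coef j] absorbs the exceptional value [B_1 = -1/2], since [B_j = 0] for the
   other odd [j]. *)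
Definition exponent_coef (u v : C) (j : nat) : C :=
  (- (1)) ^ j * INR (fact (pred j)) * ((u + v) * bern_coef j - bern_diff u v (S j)).

Lemma conv_bern_diff_todd (u v : C) (n : nat) :
  conv (bern_diff u v) todd_coef n = exp_coef u n + exp_coef v n - 2 * exp_coef 0 n.
Proof.
  rewrite <- !conv_bern_poly_todd. unfold conv, bern_diff.
  rewrite <- Csum_mult_l, <- Csum_plus, <- Csum_minus. apply Csum_ext. intros; ring.
Qed.

Lemma bern_coef_0 : bern_coef 0 = 1%R.
Proof. reflexivity. Qed.

Lemma bern_coef_1 : bern_coef 1 = (- / 2)%R.
Proof. rewrite bern_coef_S, sum_O, bern_coef_0. simpl. field. Qed.

Lemma bern_poly_coef_0 (t : C) : bern_poly_coef t 0 = 1.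
Proof. unfold bern_poly_coef, conv. rewrite Csum_O, bern_coef_0. unfold exp_coef; simpl. field. Qed.

Lemma bern_poly_coef_1 (t : C) : bern_poly_coef t 1 = t - / 2.
Proof.
  unfold bern_poly_coef, conv. rewrite Csum_S, Csum_O, bern_coef_0, bern_coef_1.
  unfold exp_coef; simpl. rewrite RtoC_opp, RtoC_inv by lra. field.
Qed.

Lemma exp_coef_0_S (n : nat) : exp_coef 0 (S n) = 0.
Proof. unfold exp_coef. rewrite Cpow_S. unfold Cdiv. ring. Qed.

Lemma m1_pow_add_sub (i k : nat) : (- (1)) ^ (i + k) * (- (1)) ^ k = (- (1)) ^ i.
Proof.
  rewrite Cpow_add_r, <- Cmult_assoc, <- Cpow_mult_l.
  replace (- (1) * - (1)) with (RtoC 1) by ring. rewrite Cpow_1_l. ring.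
Qed.

Lemma RtoC_m1 : RtoC (-1) = - (1).
Proof. apply C_eq; simpl; ring. Qed.

(** The coefficient of [y^(r+2)] in the increment identity. With the binomial coefficients written
    out, the left side becomes two convolutions with [todd_coef]: that of the Bernoulli numbers
    lacks its term 0, that of [bern_diff] its terms 0 and 1. The missing terms both amount to
    [(u + v) * todd_coef (r + 1)] and cancel, which accounts for the summand with [bern_coef j] in
    [exponent_coef]. *)
Lemma exponent_coef_identity (u v : C) (r : nat) :
  Csum (fun i => exponent_coef u v (S i) * shift_coef (S i) (r + 2)) r
  = log_coef (r + 2) * (u ^ (r + 2) + v ^ (r + 2)).
Proof.
  assert (E : forall i, (i <= r)%nat ->
    exponent_coef u v (S i) * shift_coef (S i) (r + 2)
    = (- (1)) ^ r * INR (fact (r + 1))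
      * ((u + v) * (bern_coef (S i) * todd_coef (r - i)) - bern_diff u v (S (S i)) * todd_coef (r - i))).
  { intros i Hi. replace (r + 2)%nat with (S i + S (r - i))%nat by lia.
    rewrite shift_coef_fact. unfold exponent_coef, todd_coef. cbn [pred].
    assert (A := INR_fact_neq_0_C i). assert (B := INR_fact_neq_0_C (S (r - i))).
    rewrite RtoC_div by (apply Rmult_integral_contrapositive_currified; apply INR_fact_neq_0).
    rewrite !RtoC_mult, RtoC_pow, RtoC_m1.
    replace (i + S (r - i))%nat with (r + 1)%nat by lia.
    rewrite <- (m1_pow_add_sub r (S (r - i)) : _ = (- (1)) ^ r).
    replace (r + S (r - i))%nat with (i + 1 + 2 * (r - i))%nat by lia.
    rewrite Cpow_add_r, Cpow_mult_r. replace ((- (1)) ^ 2) with (RtoC 1) by (simpl; ring).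
    rewrite Cpow_1_l. replace (i + 1)%nat with (S i) by lia. field. auto. }
  rewrite (Csum_ext _ _ _ E), Csum_mult_l, Csum_minus, Csum_mult_l.
  assert (H1 := conv_bern_todd (r + 1)). assert (H2 := conv_bern_diff_todd u v (r + 2)).
  replace (r + 1)%nat with (S r) in * by lia. replace (r + 2)%nat with (S (S r)) in * by lia.
  unfold conv in H1, H2. rewrite Csum_shift in H1. rewrite !Csum_shift in H2.
  simpl Nat.eqb in H1. cbv iota in H1. simpl Nat.sub in H1, H2.
  rewrite exp_coef_0_S in H2.
  replace (bern_diff u v 0) with (RtoC 0) in H2 by (unfold bern_diff; rewrite !bern_poly_coef_0; ring).
  replace (bern_diff u v 1) with (u + v) in H2 by (unfold bern_diff; rewrite !bern_poly_coef_1; ring).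
  rewrite bern_coef_0 in H1.
  set (S1 := Csum (fun k => bern_coef (S k) * todd_coef (r - k)) r) in *.
  set (S2 := Csum (fun k => bern_diff u v (S (S k)) * todd_coef (r - k)) r) in *.
  replace S1 with (- todd_coef (S r)).
  2: { transitivity (0 - 1 * todd_coef (S r)); [ring|]. rewrite <- H1. ring. }
  replace S2 with (exp_coef u (S (S r)) + exp_coef v (S (S r)) - (u + v) * todd_coef (S r)).
  2: { transitivity (exp_coef u (S (S r)) + exp_coef v (S (S r)) - 2 * 0 - (u + v) * todd_coef (S r));
       [ring|]. rewrite <- H2. ring. }
  unfold log_coef, exp_coef, todd_coef.
  rewrite RtoC_div by (apply not_0_INR; lia). rewrite RtoC_pow, RtoC_m1.
  rewrite (fact_simpl (S r)), mult_INR, RtoC_mult, (Cpow_S _ r).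
  assert (A := INR_fact_neq_0_C (S r)). assert (B := INR_S_neq_0_C (S r)).
  field. auto.
Qed.

(** Coefficients of [y^m] are compared for [m <= P + 2]. In degree 1 the centering [- (u + v) y]
    cancels the linear terms of the logarithms; degree [r + 2] is [exponent_coef_identity], whose
    indices [i <= r <= P] are all present. *)
Lemma increment_expansion_vanishes (u v : C) (P : nat) (y : R) :
  - (u + v) * y + Csum (fun m => log_coef m * (u * y) ^ m) (P + 2)
  + Csum (fun m => log_coef m * (v * y) ^ m) (P + 2)
  = Csum (fun i => exponent_coef u v (S i)
        * (Csum (fun m => shift_coef (S i) m * y ^ m) (P + 2) - y ^ S i)) P.
Proof.
  set (M := (P + 2)%nat).
  assert (single : forall k (c : C), (k <= M)%nat ->
     c * y ^ k = Csum (fun m => (if Nat.eqb m k then c else 0) * y ^ m) M).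
  { intros k c Hk. rewrite (Csum_single _ k _ Hk).
    - rewrite Nat.eqb_refl. reflexivity.
    - intros i _ Hi. destruct (Nat.eqb_spec i k); [lia|]. ring. }
  transitivity (Csum (fun m => ((if Nat.eqb m 1 then - (u + v) else 0)
      + log_coef m * (u ^ m + v ^ m)) * y ^ m) M).
  { replace (- (u + v) * y) with (- (u + v) * y ^ 1) by ring.
    rewrite (single 1%nat) by (unfold M; lia). rewrite <- !Csum_plus.
    apply Csum_ext. intros m _. rewrite !Cpow_mult_l. ring. }
  transitivity (Csum (fun i => Csum (fun m => exponent_coef u v (S i)
      * (shift_coef (S i) m - (if Nat.eqb m (S i) then 1 else 0)) * y ^ m) M) P).
  2: { apply Csum_ext. intros i Hi.
       replace (RtoC y ^ S i) with (1 * RtoC y ^ S i) by ring.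
       rewrite (single (S i)), <- Csum_minus, <- Csum_mult_l by (unfold M; lia).
       apply Csum_ext. intros; ring. }
  rewrite (Csum_switch (fun i m => exponent_coef u v (S i)
      * (shift_coef (S i) m - (if Nat.eqb m (S i) then 1 else 0)) * y ^ m)).
  apply Csum_ext. intros m Hm.
  transitivity (y ^ m * Csum (fun i => exponent_coef u v (S i)
      * (shift_coef (S i) m - (if Nat.eqb m (S i) then 1 else 0))) P).
  2: { rewrite <- Csum_mult_l. apply Csum_ext; intros; ring. }
  rewrite (Cmult_comm _ (y ^ m)). f_equal.
  destruct m as [|[|r]].
  - rewrite Csum_zero; [simpl; ring|]. intros i _. simpl. ring.
  - rewrite Csum_zero.
    + unfold log_coef. simpl. rewrite Rdiv_1_r. ring.
    + intros i _. destruct i as [|i]; [simpl; ring_simplify|].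
      * replace (1 - 0)%R with 1%R by ring. ring.
      * rewrite (shift_coef_lt (S (S i)) 1) by lia. simpl. ring.
  - simpl Nat.eqb at 1. cbv iota. rewrite Cplus_0_l.
    replace (S (S r)) with (r + 2)%nat by lia. rewrite <- exponent_coef_identity.
    (* Past [r], only [i = r + 1] has a nonzero shift coefficient; it is 1 and is cancelled by the
       subtracted power [y^(r+2)]. *)
    rewrite (Csum_truncate _ r P); [|unfold M in Hm; lia|].
    + symmetry. apply Csum_ext. intros i Hi. destruct (Nat.eqb_spec (r + 2) (S i)); [lia|]. ring.
    + intros i Hi. destruct (Nat.eqb_spec (r + 2) (S i)) as [->|Hne].
      * rewrite shift_coef_diag. ring.
      * rewrite shift_coef_lt by lia. ring.
Qed.

(** * Asymptotics of the product up to its limit *)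

Lemma shift_expansion_sum (a : nat -> C) (P M : nat) :
  exists D : R, forall y : R, (0 <= y)%R ->
    (Cmod (Csum (fun i => a i * (RtoC (y / (1 + y)) ^ S i
       - Csum (fun m => shift_coef (S i) m * y ^ m) M))%C P) <= D * y ^ S M)%R.
Proof.
  assert (single : forall i, exists D : R, forall y : R, (0 <= y)%R ->
    (Cmod (a i * (RtoC (y / (1 + y)) ^ S i
       - Csum (fun m => shift_coef (S i) m * y ^ m)%C M)) <= D * y ^ S M)%R).
  { intros i. destruct (shift_expansion (S i) M) as [D [HD H]].
    exists (Cmod (a i) * D)%R. intros y Hy. rewrite Cmod_mult, Rmult_assoc.
    apply Rmult_le_compat_l; [apply Cmod_ge_0|].
    replace (RtoC (y / (1 + y)) ^ S i - Csum (fun m => shift_coef (S i) m * y ^ m) M)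
      with (RtoC ((y / (1 + y)) ^ S i - sum_n (fun m => shift_coef (S i) m * y ^ m)%R M)).
    - rewrite Cmod_R. apply H, Hy.
    - rewrite RtoC_minus, RtoC_pow. f_equal. clear.
      induction M as [|M IH]; [rewrite sum_O, Csum_O | rewrite sum_Sn, Csum_S, <- IH];
        cbv beta; rewrite <- ?RtoC_pow, <- ?RtoC_mult, <- ?RtoC_plus; reflexivity. }
  induction P as [|P [D IH]].
  - destruct (single O) as [D H]. exists D. intros y Hy. rewrite Csum_O. auto.
  - destruct (single (S P)) as [D' H]. exists (D + D')%R. intros y Hy.
    rewrite Csum_S, Rmult_plus_distr_r.
    eapply Rle_trans; [apply Cmod_triangle | apply Rplus_le_compat; auto].
Qed.

(** Here [y] stands for [1/(n+1)], so that [y/(1 + y)] is [1/(n+2)]: the left side carries the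
    factor of index [n + 1] and the new exponent, the right side the old exponent. *)
Lemma factor_increment (u v : C) (P : nat) :
  exists D : R, (0 <= D)%R /\ forall y : R, (0 <= y)%R -> (Cmod u * y <= 1 / 2)%R ->
    (Cmod v * y <= 1 / 2)%R ->
    exists e : C,
      Cexp (- (u + v) * y) * ((1 + u * y) * (1 + v * y))
        * Cexp (- Csum (fun i => exponent_coef u v (S i) * RtoC (y / (1 + y)) ^ S i) P)
      = Cexp (- Csum (fun i => exponent_coef u v (S i) * y ^ S i) P) * Cexp e
      /\ (Cmod e <= D * y ^ (P + 3))%R.
Proof.
  destruct (shift_expansion_sum (fun i => exponent_coef u v (S i)) P (P + 2)) as [D0 H0].
  (* Two logarithm remainders, each with the constant 4, and the remainder of the shifted powers. *)
  set (D := (4 * Cmod u ^ (P + 3) + 4 * Cmod v ^ (P + 3) + Rabs D0)%R).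
  exists D. split.
  { unfold D. assert (A := pow_le _ (P + 3) (Cmod_ge_0 u)). assert (B := pow_le _ (P + 3) (Cmod_ge_0 v)).
    assert (C := Rabs_pos D0). lra. }
  intros y Hy Hu Hv.
  assert (Hu' : (Cmod (u * y) <= 1 / 2)%R) by (rewrite Cmod_mult, Cmod_R, (Rabs_pos_eq y Hy); exact Hu).
  assert (Hv' : (Cmod (v * y) <= 1 / 2)%R) by (rewrite Cmod_mult, Cmod_R, (Rabs_pos_eq y Hy); exact Hv).
  destruct (log_expansion _ Hu') as [lu [Eu Bu]], (log_expansion _ Hv') as [lv [Ev Bv]].
  specialize (H0 y Hy). specialize (Bu (P + 2)%nat). specialize (Bv (P + 2)%nat).
  set (Lu := Csum (fun k => log_coef k * (u * y) ^ k) (P + 2)) in *.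
  set (Lv := Csum (fun k => log_coef k * (v * y) ^ k) (P + 2)) in *.
  set (Sq := Csum (fun i => exponent_coef u v (S i) * RtoC (y / (1 + y)) ^ S i) P).
  set (Sy := Csum (fun i => exponent_coef u v (S i) * y ^ S i) P).
  exists (- (u + v) * y + lu + lv - Sq + Sy). split.
  - rewrite <- Eu, <- Ev, <- !Cexp_plus. f_equal. ring.
  - set (X := Csum (fun i => exponent_coef u v (S i) * (RtoC (y / (1 + y)) ^ S i -
         Csum (fun m => shift_coef (S i) m * y ^ m) (P + 2))) P) in *.
    (* All polynomial parts cancel by [increment_expansion_vanishes]; three remainders of order
       [P + 3] are left. *)
    replace (- (u + v) * y + lu + lv - Sq + Sy) with ((lu - Lu) + (lv - Lv) + - X).
    2: { assert (E := increment_expansion_vanishes u v P y). fold Lu Lv in E.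
         replace (Csum _ P) with ((Sq - Sy) - X) in E.
         - transitivity (lu + lv - Sq + Sy + (Sq - Sy - X) - Lu - Lv); [ring|]. rewrite <- E. ring.
         - unfold Sq, Sy, X. rewrite <- !Csum_minus. apply Csum_ext. intros; ring. }
    eapply Rle_trans; [apply Cmod_triangle|]. rewrite Cmod_opp.
    eapply Rle_trans; [apply Rplus_le_compat_r, Cmod_triangle|].
    rewrite Cmod_mult, Cmod_R, (Rabs_pos_eq y Hy), Rpow_mult_distr in Bu, Bv.
    replace (S (P + 2)) with (P + 3)%nat in * by lia.
    assert (A := pow_le _ (P + 3) Hy).
    assert (B := Rmult_le_compat_r _ _ _ A (Rle_abs D0)).
    unfold D. lra.
Qed.

Lemma Cdiv_RtoC_inv (z : C) (x : R) : x <> 0%R -> z / x = z * RtoC (/ x).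
Proof. intros H. rewrite RtoC_inv by exact H. reflexivity. Qed.

Lemma W_S (u v : C) (n : nat) :
  W (u + v) (u * v) (S n) = W (u + v) (u * v) n
    * (Cexp (- (u + v) * RtoC (/ INR (S n)))
       * ((1 + u * RtoC (/ INR (S n))) * (1 + v * RtoC (/ INR (S n))))).
Proof.
  unfold W. cbn [Cprod]. cbv zeta. rewrite RtoC_inv by (apply not_0_INR; lia).
  assert (A := INR_S_neq_0_C n). f_equal. f_equal. field. exact A.
Qed.

(** Here N is [P + 1]. Beyond [n0] every ratio is an exponential, so the single value at [n0]
    decides whether the limit vanishes. *)
Lemma W_asymptotic (u v : C) (P : nat) :
  exists (L : C) (err : nat -> C) (n0 : nat) (M : R),
    Clim (W (u + v) (u * v)) L /\ (1 <= n0)%nat /\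
    (W (u + v) (u * v) n0 <> 0 -> L <> 0) /\
    forall n, (n0 <= n)%nat ->
      (Cmod (err n) <= M / INR n ^ (P + 2))%R /\
      W (u + v) (u * v) n =
        L * Cexp (Csum (fun i => exponent_coef u v (S i) * RtoC (/ INR (S n)) ^ S i) P + err n).
Proof.
  destruct (factor_increment u v P) as [D [HD H]].
  set (s := fun n => Csum (fun i => exponent_coef u v (S i) * RtoC (/ INR (S n)) ^ S i) P).
  set (F := fun n => W (u + v) (u * v) n * Cexp (- s n)).
  (* From here on [|u|/(n+1)] and [|v|/(n+1)] are at most 1/2, as the logarithms require. *)
  destruct (INR_unbounded (2 * (Cmod u + Cmod v))) as [n1 Hn1].
  assert (Cu := Cmod_ge_0 u). assert (Cv := Cmod_ge_0 v).
  set (n0 := S n1).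
  destruct (product_asymptotic F n0 (P + 2) D) as [L [err [HL [Hne Herr]]]]; try (unfold n0; lia).
  { intros n Hn.
    assert (I1 : (INR n1 <= INR n)%R) by (apply le_INR; unfold n0 in Hn; lia).
    assert (I2 : (1 <= INR n)%R) by (apply (le_INR 1); unfold n0 in Hn; lia).
    set (y := (/ INR (S n))%R).
    assert (Hy : (0 < y)%R) by (apply Rinv_0_lt_compat, lt_0_INR; lia).
    assert (Hy1 : (INR (S n) * y = 1)%R) by (apply Rinv_r, not_0_INR; lia).
    assert (Hn' : (INR (S n) = INR n + 1)%R) by apply S_INR.
    destruct (H y) as [e [E B]]; try nra.
    exists e. split.
    - unfold F. rewrite W_S. fold y.
      replace (s (S n)) with (Csum (fun i => exponent_coef u v (S i) * RtoC (y / (1 + y)) ^ S i) P).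
      2: { unfold s. replace (/ INR (S (S n)))%R with (y / (1 + y))%R; [reflexivity|].
           rewrite (S_INR (S n)). unfold y. field. split; rewrite <- ?S_INR; apply not_0_INR; lia. }
      rewrite <- Cmult_assoc, E. fold y. unfold s. fold y. ring.
    - eapply Rle_trans; [exact B|]. unfold Rdiv. apply Rmult_le_compat_l; [exact HD|].
      replace (P + 2 + 1)%nat with (P + 3)%nat by lia.
      rewrite <- pow_inv. apply pow_incr. split; [lra|].
      apply Rinv_le_contravar; lra. }
  (* The exponent tends to 0, so [W] has the same limit as [F]. *)
  assert (Hs : Clim (fun n => Cexp (s n)) 1).
  { rewrite <- Cexp_0. apply Clim_Cexp.
    assert (Y : Clim (fun n => RtoC (/ INR (S n))) 0).
    { apply Clim_RtoC. apply is_lim_seq_incr_1 with (u := fun n => (/ INR n)%R).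
      apply (is_lim_seq_inv _ p_infty); [apply is_lim_seq_INR | discriminate]. }
    assert (Y' : forall i, Clim (fun n => exponent_coef u v (S i) * RtoC (/ INR (S n)) ^ S i) 0).
    { intros i. replace (RtoC 0) with (exponent_coef u v (S i) * 0) by ring.
      apply Clim_mult; [apply Clim_const|].
      induction i as [|i IH].
      - apply Clim_ext with (2 := Y). intros; simpl; ring.
      - replace (RtoC 0) with (0 * 0) by ring. apply (Clim_mult _ _ _ _ Y IH). }
    unfold s. clear -Y'. induction P as [|P IH].
    - apply Clim_ext with (2 := Y' O). intros; rewrite Csum_O; reflexivity.
    - replace (RtoC 0) with (0 + 0) by ring.
      apply Clim_ext with (2 := Clim_plus _ _ _ _ IH (Y' (S P))).
      intros; rewrite Csum_S; reflexivity. }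
  assert (EF : forall n, W (u + v) (u * v) n = F n * Cexp (s n)).
  { intros n. unfold F. rewrite Cexp_opp. field. apply Cexp_neq_0. }
  exists L, err, n0, (2 ^ (P + 2) * D)%R. repeat split.
  - replace (Re L) with (Re (L * 1)) by (f_equal; ring).
    apply is_lim_seq_ext with (2 := proj1 (Clim_mult _ _ _ _ HL Hs)). intros; rewrite EF; reflexivity.
  - replace (Im L) with (Im (L * 1)) by (f_equal; ring).
    apply is_lim_seq_ext with (2 := proj2 (Clim_mult _ _ _ _ HL Hs)). intros; rewrite EF; reflexivity.
  - unfold n0; lia.
  - intros HW. apply Hne. unfold F. apply Cmult_neq_0; [exact HW | apply Cexp_neq_0].
  - apply Herr, H0.
  - fold (s n). rewrite EF, (proj1 (Herr n H0)), Cexp_plus. ring.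
Qed.

(** The exponentials split because the first parameter is [u + v], so the limit can be found for one
    root at a time. *)
Lemma W_mult (u v : C) (n : nat) : W (u + v) (u * v) n = W u 0 n * W v 0 n.
Proof.
  induction n as [|n IH]; [unfold W; simpl; ring|].
  rewrite W_S, IH.
  assert (E : forall w, W w 0 (S n)
    = W w 0 n * (Cexp (- w * RtoC (/ INR (S n))) * (1 + w * RtoC (/ INR (S n))))).
  { intros w. assert (Q := W_S w 0 n). rewrite Cplus_0_r, Cmult_0_r in Q. rewrite Q. ring. }
  rewrite !E.
  replace (- (u + v) * RtoC (/ INR (S n))) with (- u * RtoC (/ INR (S n)) + - v * RtoC (/ INR (S n))) by ring.
  rewrite Cexp_plus. ring.
Qed.

(** * Euler's integral *)

Definition Cpower (s : C) (t : R) : C := Cexp (s * ln t).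

Lemma Cmod_Cpower (s : C) (t : R) : Cmod (Cpower s t) = exp (Re s * ln t).
Proof. unfold Cpower. rewrite Cmod_Cexp, re_scal_r. reflexivity. Qed.

Lemma Cpower_plus_1 (s : C) (t : R) : (0 < t)%R -> Cpower (s + 1) t = t * Cpower s t.
Proof.
  intros Ht. unfold Cpower. rewrite Cmult_plus_distr_r, Cexp_plus, Cmult_1_l, Cexp_RtoC, exp_ln by exact Ht.
  ring.
Qed.

Lemma Cderive_Cpower (s : C) (t : R) : (0 < t)%R ->
  Cderive (Cpower s) t (s * Cpower (s - 1) t).
Proof.
  intros Ht. eapply Cderive_eq.
  - apply Cderive_Cexp, Cderive_Cmult_l, Cderive_RtoC, is_derive_ln, Ht.
  - cbv beta. change (Cexp (s * ln t)) with (Cpower s t). replace (Cpower s t) with (t * Cpower (s - 1) t)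
      by (rewrite <- Cpower_plus_1 by exact Ht; f_equal; ring).
    rewrite RtoC_inv by lra.
    assert (RtoC t <> 0) by (intros E; apply RtoC_inj in E; lra). field. assumption.
Qed.

(* Antiderivative of [t^(s-1) (1 - t/n)^m], from repeated integration by parts. *)
Fixpoint euler_primitive (n : R) (m : nat) (s : C) (t : R) : C :=
  match m with
  | O => / s * Cpower s t
  | S k => / s * (Cpower s t * RtoC ((1 - t / n) ^ m))
           + INR m / (n * s) * euler_primitive n k (s + 1) t
  end.

Lemma Re_pos_neq_0 (s : C) : (0 < Re s)%R -> s <> 0.
Proof. intros H E. rewrite E in H. simpl in H. lra. Qed.

Lemma Cderive_euler_primitive (n : R) (m : nat) (s : C) (t : R) :
  (0 < n)%R -> (0 < Re s)%R -> (0 < t)%R ->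
  Cderive (euler_primitive n m s) t (Cpower (s - 1) t * RtoC ((1 - t / n) ^ m)).
Proof.
  intros Hn. revert s. induction m as [|k IH]; intros s Hs Ht.
  - eapply Cderive_eq.
    { cbn [euler_primitive]. apply Cderive_Cmult_l, Cderive_Cpower, Ht. }
    simpl. field. apply Re_pos_neq_0, Hs.
  - assert (Hs1 : (0 < Re (s + 1))%R) by (rewrite re_plus, re_RtoC; lra).
    eapply Cderive_eq.
    { cbn [euler_primitive]. apply Cderive_plus.
      - apply Cderive_Cmult_l, Cderive_mult; [apply Cderive_Cpower, Ht|].
        apply Cderive_RtoC with (l := (- INR (S k) / n * (1 - t / n) ^ k)%R).
        auto_derive; [exact I|]. change (pred (S k)) with k.
        change (match k with O => 1 | S _ => INR k + 1 end)%R with (INR (S k)).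
        unfold Rdiv, Rminus. ring.
      - apply Cderive_Cmult_l, IH; assumption. }
    replace (s + 1 - 1) with s by ring.
    assert (Hn0 : RtoC n <> 0) by (intros E; apply RtoC_inj in E; lra).
    assert (Hs0 := Re_pos_neq_0 s Hs).
    replace (RtoC (- INR (S k) / n * (1 - t / n) ^ k))
      with (- (INR (S k) / n) * RtoC ((1 - t / n) ^ k)).
    + field. auto.
    + rewrite RtoC_mult, RtoC_div, RtoC_opp by lra. field. exact Hn0.
Qed.

Lemma Cprod_shift (f : nat -> C) (n : nat) :
  Cprod f (S n) = f O * Cprod (fun k => f (S k)) n.
Proof.
  induction n as [|n IH]; [simpl; ring|].
  cbn [Cprod] in *. rewrite IH. ring.
Qed.

Lemma Cprod_ext (f g : nat -> C) (n : nat) :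
  (forall k, (k < n)%nat -> f k = g k) -> Cprod f n = Cprod g n.
Proof.
  induction n as [|n IH]; intros H; [reflexivity|].
  cbn [Cprod]. rewrite IH, H by (intros; try apply H; lia). reflexivity.
Qed.

Lemma Cprod_neq_0 (f : nat -> C) (n : nat) :
  (forall k, (k < n)%nat -> f k <> 0) -> Cprod f n <> 0.
Proof.
  induction n as [|n IH]; intros H.
  - intros E. apply RtoC_inj in E. lra.
  - cbn [Cprod]. apply Cmult_neq_0; [apply IH; intros; apply H; lia | apply H; lia].
Qed.

Lemma Re_plus_INR_pos (s : C) (k : nat) : (0 < Re s)%R -> (0 < Re (s + INR k))%R.
Proof. intros H. rewrite re_plus, re_RtoC. assert (A := pos_INR k). lra. Qed.

(** At [t = n] every boundary term containing [1 - t/n] vanishes and only the innermost one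
    survives; each power of [n] gained from [s + 1] cancels a denominator [n]. For [m = n] this is
    the term of Gauss's product. *)
Lemma euler_primitive_endpoint (n : R) (m : nat) (s : C) : (0 < n)%R -> (0 < Re s)%R ->
  euler_primitive n m s n = Cpower s n * INR (fact m) / Cprod (fun k => s + INR k) (S m).
Proof.
  intros Hn. revert s. induction m as [|k IH]; intros s Hs.
  - assert (Hs0 := Re_pos_neq_0 s Hs). cbn [euler_primitive Cprod fact]. simpl (INR 0). simpl (INR 1).
    rewrite Cplus_0_r. field. exact Hs0.
  - assert (Hs1 : (0 < Re (s + 1))%R) by (rewrite re_plus, re_RtoC; lra).
    assert (Hn0 : RtoC n <> 0) by (intros E; apply RtoC_inj in E; lra).
    assert (Hs0 := Re_pos_neq_0 s Hs).
    rewrite Cprod_shift.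
    rewrite (Cprod_ext _ (fun j => s + 1 + INR j)) by (intros; rewrite S_INR, RtoC_plus; ring).
    cbn [euler_primitive]. rewrite IH, Cpower_plus_1 by assumption.
    replace (1 - n / n)%R with 0%R by (field; lra).
    assert (HP : Cprod (fun j => s + 1 + INR j) (S k) <> 0).
    { apply Cprod_neq_0. intros j _. apply Re_pos_neq_0, Re_plus_INR_pos, Hs1. }
    rewrite (fact_simpl k), mult_INR, RtoC_mult. simpl (0 ^ S k)%R. rewrite Rmult_0_l.
    simpl (INR 0). rewrite Cplus_0_r. field. auto.
Qed.

(** The bound is uniform in [m <= n]. Since [m/n <= 1] and [2 t <= 1], the bound for [s + 1]
    contributes at most [t^(Re s) / Re s], as much as the boundary term, so the constant 2
    reproduces itself. *)
Lemma euler_primitive_near_0 (n : R) (m : nat) (s : C) (t : R) :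
  (INR m <= n)%R -> (0 < n)%R -> (0 < Re s)%R -> (0 < t <= 1 / 2)%R ->
  (Cmod (euler_primitive n m s t) <= 2 * exp (Re s * ln t) / Re s)%R.
Proof.
  intros Hm Hn. revert s Hm. induction m as [|k IH]; intros s Hm Hs Ht.
  - cbn [euler_primitive].
    rewrite Cmod_mult, Cmod_inv, Cmod_Cpower by (apply Re_pos_neq_0, Hs).
    assert (E := exp_pos (Re s * ln t)).
    assert (R1 : (Re s <= Cmod s)%R) by (eapply Rle_trans; [apply Rle_abs | apply re_le_Cmod]).
    assert (I : (/ Cmod s <= / Re s)%R) by (apply Rinv_le_contravar; lra).
    assert (I0 : (0 < / Re s)%R) by (apply Rinv_0_lt_compat; lra).
    unfold Rdiv. nra.
  - assert (Hs1 : (0 < Re (s + 1))%R) by (rewrite re_plus, re_RtoC; lra).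
    assert (Hn0 : RtoC n <> 0) by (intros E; apply RtoC_inj in E; lra).
    assert (Hs0 := Re_pos_neq_0 s Hs).
    assert (Hk : (INR k <= n)%R) by (eapply Rle_trans; [|exact Hm]; apply le_INR; lia).
    specialize (IH (s + 1) Hk Hs1 Ht). rewrite re_plus, re_RtoC in IH.
    rewrite Rmult_plus_distr_r, exp_plus, Rmult_1_l, exp_ln in IH by lra.
    set (E := exp (Re s * ln t)) in *.
    assert (HE : (0 < E)%R) by apply exp_pos.
    assert (R1 : (Re s <= Cmod s)%R) by (eapply Rle_trans; [apply Rle_abs | apply re_le_Cmod]).
    assert (I : (/ Cmod s <= / Re s)%R) by (apply Rinv_le_contravar; lra).
    assert (I0 : (0 < / Cmod s)%R) by (apply Rinv_0_lt_compat; lra).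
    assert (Q : (0 <= (1 - t / n) ^ S k <= 1)%R).
    { assert (T : (0 <= t / n <= 1)%R).
      { assert (1 <= n)%R by (eapply Rle_trans; [|exact Hm]; apply (le_INR 1); lia).
        split; [apply Rdiv_le_0_compat; lra|]. apply Rmult_le_reg_r with n; [lra|].
        unfold Rdiv. rewrite Rmult_assoc, Rinv_l by lra. lra. }
      split; [apply pow_le; lra|].
      apply Rle_trans with (1 ^ S k)%R; [apply pow_incr; lra | rewrite pow1; lra]. }
    cbn [euler_primitive]. eapply Rle_trans; [apply Cmod_triangle|].
    rewrite !Cmod_mult, Cmod_inv, Cmod_div, Cmod_mult, !Cmod_R, Cmod_Cpower by (try apply Cmult_neq_0; auto).
    fold E. rewrite (Rabs_pos_eq _ (proj1 Q)), (Rabs_pos_eq (INR _)) by apply pos_INR.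
    rewrite (Rabs_pos_eq n) by lra.
    assert (B1 : (/ Cmod s * (E * (1 - t / n) ^ S k) <= / Re s * E)%R).
    { set (x := ((1 - t / n) ^ S k)%R) in *. apply Rmult_le_compat; [lra | nra | exact I | nra]. }
    assert (B2 : (INR (S k) / (n * Cmod s) * Cmod (euler_primitive n k (s + 1) t) <= / Re s * E)%R).
    { apply Rmult_le_compat.
      - apply Rdiv_le_0_compat; [apply pos_INR | nra].
      - apply Cmod_ge_0.
      - unfold Rdiv. rewrite Rinv_mult.
        apply Rle_trans with (1 * / Cmod s)%R; [|lra]. rewrite <- Rmult_assoc.
        apply Rmult_le_compat_r; [lra|]. apply Rmult_le_reg_r with n; [lra|].
        rewrite Rmult_assoc, Rinv_l by lra. lra.
      - eapply Rle_trans; [exact IH|]. apply Rmult_le_reg_r with (Re s + 1)%R; [lra|].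
        unfold Rdiv. rewrite Rmult_assoc, Rinv_l by lra. nra. }
    unfold Rdiv. lra.
Qed.

Lemma C_FTC (F f : R -> C) (a b : R) : (a <= b)%R ->
  (forall t, (a <= t <= b)%R -> Cderive F t (f t)) ->
  (forall t, (a <= t <= b)%R -> continuous (fun x => Re (f x)) t) ->
  (forall t, (a <= t <= b)%R -> continuous (fun x => Im (f x)) t) ->
  is_RInt (V := C_R_NormedModule) f a b (F b - F a).
Proof.
  intros Hab H H1 H2.
  apply (is_RInt_fct_extend_pair (U := R_NormedModule) (V := R_NormedModule) f a b
    (Re (F b - F a)) (Im (F b - F a))).
  - apply (is_RInt_derive (V := R_CompleteNormedModule) (fun x => Re (F x)) (fun x => Re (f x)));
      rewrite Rmin_left, Rmax_right by exact Hab; [intros; apply H; auto | exact H1].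
  - apply (is_RInt_derive (V := R_CompleteNormedModule) (fun x => Im (F x)) (fun x => Im (f x)));
      rewrite Rmin_left, Rmax_right by exact Hab; [intros; apply H; auto | exact H2].
Qed.

Lemma C_ex_RInt (f : R -> C) (a b : R) : (a <= b)%R ->
  (forall t, (a <= t <= b)%R -> continuous (fun x => Re (f x)) t) ->
  (forall t, (a <= t <= b)%R -> continuous (fun x => Im (f x)) t) ->
  exists z : C, is_RInt (V := C_R_NormedModule) f a b z.
Proof.
  intros Hab H1 H2.
  destruct (ex_RInt_continuous (V := R_CompleteNormedModule) (fun x => Re (f x)) a b) as [x Hx].
  { rewrite Rmin_left, Rmax_right by exact Hab; exact H1. }
  destruct (ex_RInt_continuous (V := R_CompleteNormedModule) (fun x => Im (f x)) a b) as [y Hy].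
  { rewrite Rmin_left, Rmax_right by exact Hab; exact H2. }
  exists (x, y). apply (is_RInt_fct_extend_pair (U := R_NormedModule) (V := R_NormedModule)); assumption.
Qed.

Lemma Cderive_continuous (f : R -> C) (t : R) (l : C) : Cderive f t l ->
  continuous (fun x => Re (f x)) t /\ continuous (fun x => Im (f x)) t.
Proof.
  intros [H1 H2]. split.
  - apply (ex_derive_continuous (V := R_NormedModule)). eexists; exact H1.
  - apply (ex_derive_continuous (V := R_NormedModule)). eexists; exact H2.
Qed.

Lemma Cmod_RInt_le (f : R -> C) (g : R -> R) (a b : R) (lf : C) (lg : R) : (a <= b)%R ->
  (forall t, (a <= t <= b)%R -> (Cmod (f t) <= g t)%R) ->
  is_RInt (V := C_R_NormedModule) f a b lf -> is_RInt g a b lg -> (Cmod lf <= lg)%R.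
Proof.
  intros Hab H Hf Hg. rewrite Cmod_norm.
  apply (norm_RInt_le (V := C_R_NormedModule) f g a b lf lg Hab); auto.
  intros x Hx. rewrite <- Cmod_norm. auto.
Qed.

(** * Comparison of [e^(-t)] with [(1 - t/n)^n], and passage to the limit *)

Lemma one_minus_div_pow_le_exp (t : R) (n : nat) : (0 <= t <= INR n)%R -> (1 <= n)%nat ->
  (0 <= (1 - t / INR n) ^ n <= exp (- t))%R.
Proof.
  intros Ht Hn. assert (Hp : (0 < INR n)%R) by (apply lt_0_INR; lia).
  assert (T : (0 <= t / INR n <= 1)%R).
  { split; [apply Rdiv_le_0_compat; lra|]. apply Rmult_le_reg_r with (INR n); [lra|].
    unfold Rdiv. rewrite Rmult_assoc, Rinv_l by lra. lra. }
  split; [apply pow_le; lra|].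
  replace (exp (- t)) with (exp (- (t / INR n)) ^ n)%R.
  - apply pow_incr. split; [lra|]. assert (A := exp_ineq1_le (- (t / INR n))). lra.
  - rewrite <- Rpower_pow by apply exp_pos. unfold Rpower. rewrite ln_exp. f_equal. field. lra.
Qed.

Lemma pow_one_minus_ge (x : R) (n : nat) : (0 <= x <= 1)%R -> (1 - INR n * x <= (1 - x) ^ n)%R.
Proof.
  intros Hx. induction n as [|n IH]; [simpl; lra|].
  rewrite S_INR. simpl. assert (A := pos_INR n).
  apply Rle_trans with ((1 - x) * (1 - INR n * x))%R; [nra|].
  apply Rmult_le_compat_l; lra.
Qed.

(** With [x = t/n], [(1 - x) e^x >= 1 - x^2], and Bernoulli's inequality bounds the n-th power below
    by [1 - n x^2 = 1 - t^2/n]. *)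
Lemma exp_minus_pow_le (t : R) (n : nat) : (0 <= t <= INR n)%R -> (1 <= n)%nat ->
  (Rabs (exp (- t) - (1 - t / INR n) ^ n) <= exp (- t) * (t * t / INR n))%R.
Proof.
  intros Ht Hn. assert (B := one_minus_div_pow_le_exp t n Ht Hn).
  assert (Hp : (0 < INR n)%R) by (apply lt_0_INR; lia).
  rewrite Rabs_pos_eq by lra.
  set (x := (t / INR n)%R) in *.
  assert (T : (0 <= x <= 1)%R).
  { unfold x. split; [apply Rdiv_le_0_compat; lra|]. apply Rmult_le_reg_r with (INR n); [lra|].
    unfold Rdiv. rewrite Rmult_assoc, Rinv_l by lra. lra. }
  assert (E : (t = INR n * x)%R) by (unfold x; field; lra).
  assert (Ee : (exp (- t) * exp x ^ n = 1)%R).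
  { rewrite <- Rpower_pow by apply exp_pos. unfold Rpower. rewrite ln_exp, <- exp_plus.
    replace (- t + INR n * x)%R with 0%R by lra. apply exp_0. }
  assert (L : (1 - INR n * (x * x) <= ((1 - x) * exp x) ^ n)%R).
  { eapply Rle_trans; [apply pow_one_minus_ge; nra|].
    apply pow_incr. assert (A := exp_ineq1_le x). nra. }
  rewrite Rpow_mult_distr in L.
  replace (t * t / INR n)%R with (INR n * (x * x))%R by (rewrite E; field; lra).
  assert (P := exp_pos (- t)).
  apply (Rmult_le_compat_l (exp (- t))) in L; [|lra].
  replace (exp (- t) * ((1 - x) ^ n * exp x ^ n))%R
    with ((1 - x) ^ n * (exp (- t) * exp x ^ n))%R in L by ring.
  rewrite Ee in L. lra.
Qed.

Lemma power_le_exp_half (r : R) : exists M : R, (0 <= M)%R /\ forall t : R, (1 <= t)%R ->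
  (exp (r * ln t) * exp (- t) <= M * exp (- t / 2))%R.
Proof.
  (* Chosen so that [ln t <= t/k + ln k] yields [|r| ln t <= t/2 + |r| ln k]. *)
  set (k := (2 * (Rabs r + 1))%R).
  assert (A := Rabs_pos r).
  exists (exp (Rabs r * ln k)). split; [left; apply exp_pos|]. intros t Ht.
  rewrite <- !exp_plus.
  assert (Hk : (0 < k)%R) by (unfold k; lra).
  assert (L0 : (0 <= ln t)%R) by (rewrite <- ln_1; apply ln_le; lra).
  assert (L1 : (ln t <= t / k + ln k)%R).
  { replace t with (t / k * k)%R at 1 by (field; lra).
    assert (P : (0 < t / k)%R) by (apply Rdiv_lt_0_compat; lra).
    rewrite ln_mult by assumption.
    assert (B := exp_ineq1_le (ln (t / k))). rewrite exp_ln in B by exact P. lra. }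
  assert (L2 : (r * ln t <= Rabs r * ln t)%R) by (apply Rmult_le_compat_r; [exact L0 | apply Rle_abs]).
  assert (L3 : (Rabs r * (t / k) <= t / 2)%R).
  { replace (t / 2)%R with ((Rabs r + 1) * (t / k))%R by (unfold k; field; lra).
    apply Rmult_le_compat_r; [|lra]. apply Rdiv_le_0_compat; lra. }
  assert (L4 : (Rabs r * ln t <= Rabs r * (t / k + ln k))%R) by (apply Rmult_le_compat_l; lra).
  assert (L5 : (r * ln t + - t <= Rabs r * ln k + - t / 2)%R) by lra.
  destruct L5 as [L5|L5]; [left; apply exp_increasing, L5 | rewrite L5; apply Rle_refl].
Qed.

Lemma is_RInt_exp_half (M a b : R) :
  is_RInt (fun t => (M * exp (- t / 2))%R) a b (2 * M * (exp (- a / 2) - exp (- b / 2)))%R.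
Proof.
  replace (2 * M * (exp (- a / 2) - exp (- b / 2)))%R
    with (minus ((- 2 * M * exp (- b / 2)) : R) (- 2 * M * exp (- a / 2))%R).
  2: { unfold minus, plus, opp; simpl. ring. }
  apply (is_RInt_derive (V := R_CompleteNormedModule) (fun t => (- 2 * M * exp (- t / 2))%R)).
  - intros x _. auto_derive; [exact I|]. unfold Rdiv. field.
  - intros x _. apply (ex_derive_continuous (V := R_NormedModule)). auto_derive. exact I.
Qed.

(* On [a, b] the integrand is the limit of [t^(s-1) (1 - t/n)^n], whose integral over (0, n) is
   the n-th term of Gauss's product; the parts of that integral over (0, a) and (b, n) are
   bounded uniformly in n. *)
Lemma euler_integral_estimate (s : C) (G : C) : (0 < Re s)%R ->
  Clim (fun n => Cpower s (INR n) * INR (fact n) / Cprod (fun k => s + INR k) (S n)) G ->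
  exists M : R, forall a b : R, (0 < a <= 1 / 2)%R -> (1 <= b)%R ->
    exists z : C, is_RInt (V := C_R_NormedModule)
        (fun t : R => Cexp ((s - 1) * ln t) * exp (- t)) a b z /\
      (Cmod (z - G) <= 2 * exp (Re s * ln a) / Re s + M * exp (- b / 2))%R.
Proof.
  intros Hs HG.
  destruct (power_le_exp_half (Re (s - 1))) as [M [HM HMt]].
  (* The 2 comes from integrating [exp (- t / 2)]. *)
  exists (2 * M)%R. intros a b Ha Hb.
  set (f := fun t : R => Cexp ((s - 1) * ln t) * exp (- t)).
  set (fn := fun (n : nat) (t : R) => Cpower (s - 1) t * RtoC ((1 - t / INR n) ^ n)).
  assert (Cp : forall t, (0 < t)%R -> exists l, Cderive (Cpower (s - 1)) t l)
    by (intros t Ht; eexists; apply Cderive_Cpower, Ht).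
  assert (Df : forall t, (0 < t)%R -> exists l, Cderive f t l).
  { intros t Ht. destruct (Cp t Ht) as [l Hl]. eexists. apply Cderive_mult; [exact Hl|].
    apply (Cderive_RtoC (fun x => exp (- x)) t (- exp (- t))%R). auto_derive; [exact I | ring]. }
  assert (Dfn : forall n t, (0 < t)%R -> exists l, Cderive (fn n) t l).
  { intros n t Ht. destruct (Cp t Ht) as [l Hl]. eexists. apply Cderive_mult; [exact Hl|].
    apply Cderive_RtoC, Derive_correct. auto_derive. exact I. }
  assert (Cont : forall g : R -> C, (forall t, (0 < t)%R -> exists l, Cderive g t l) ->
    (forall t, (0 < t)%R -> continuous (fun x => Re (g x)) t) /\
    (forall t, (0 < t)%R -> continuous (fun x => Im (g x)) t)).
  { intros g Hg. split; intros t Ht; destruct (Hg t Ht) as [l Hl]; apply (Cderive_continuous g t l Hl). }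
  destruct (Cont f Df) as [Cf1 Cf2].
  destruct (C_ex_RInt f a b) as [z Hz];
    [lra | intros t Ht; apply Cf1; lra | intros t Ht; apply Cf2; lra |].
  exists z. split; [exact Hz|].
  (* The modulus of the integrand. Its integral [J] depends on [a] and [b], but enters only divided
     by [n] and disappears in the limit. *)
  set (h := fun t => (exp (Re (s - 1) * ln t) * exp (- t))%R).
  assert (Hh : exists J : R, is_RInt h a b J).
  { apply (ex_RInt_continuous (V := R_CompleteNormedModule)).
    rewrite Rmin_left, Rmax_right by lra. intros t Ht.
    apply (ex_derive_continuous (V := R_NormedModule)). unfold h. auto_derive. lra. }
  destruct Hh as [J HJ].
  set (E1 := (2 * exp (Re s * ln a) / Re s)%R).
  set (E2 := (2 * M * exp (- b / 2))%R).
  destruct (INR_unbounded b) as [n0 Hn0].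
  assert (key : forall n, (n0 <= n)%nat ->
    (Cmod (z - Cpower s (INR n) * INR (fact n) / Cprod (fun k => s + INR k)%C (S n))
      <= E1 + E2 + b * b * J / INR n)%R).
  { intros n Hn.
    assert (Hbn : (b <= INR n)%R) by (apply Rle_trans with (INR n0); [lra | apply le_INR, Hn]).
    assert (Hp : (0 < INR n)%R) by lra.
    assert (Hn1 : (1 <= n)%nat).
    { apply INR_le. simpl. lra. }
    destruct (Cont (fn n) (Dfn n)) as [C1 C2].
    rewrite <- euler_primitive_endpoint by assumption.
    assert (I1 : is_RInt (V := C_R_NormedModule) (fn n) a b
       (euler_primitive (INR n) n s b - euler_primitive (INR n) n s a)).
    { apply C_FTC; [lra | | |]; intros t Ht; [apply Cderive_euler_primitive | apply C1 | apply C2]; lra. }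
    assert (I2 : is_RInt (V := C_R_NormedModule) (fn n) b (INR n)
       (euler_primitive (INR n) n s (INR n) - euler_primitive (INR n) n s b)).
    { apply C_FTC; [lra | | |]; intros t Ht; [apply Cderive_euler_primitive | apply C1 | apply C2]; lra. }
    set (A := euler_primitive (INR n) n s) in *.
    assert (B1 : (Cmod (z - (A b - A a)) <= b * b * J / INR n)%R).
    { apply (Cmod_RInt_le (fun t => f t - fn n t) (fun t => (b * b / INR n * h t)%R) a b); [lra | | |].
      - intros t Ht. unfold f, fn, h. fold (Cpower (s - 1) t).
        replace (Cpower (s - 1) t * exp (- t) - Cpower (s - 1) t * RtoC ((1 - t / INR n) ^ n))
          with (Cpower (s - 1) t * RtoC (exp (- t) - (1 - t / INR n) ^ n)) by (rewrite RtoC_minus; ring).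
        rewrite Cmod_mult, Cmod_R, Cmod_Cpower.
        assert (L := exp_minus_pow_le t n ltac:(lra) Hn1).
        assert (L' : (exp (- t) * (t * t / INR n) <= exp (- t) * (b * b / INR n))%R).
        { apply Rmult_le_compat_l; [left; apply exp_pos|].
          apply Rmult_le_compat_r; [left; apply Rinv_0_lt_compat, Hp | nra]. }
        assert (P := exp_pos (Re (s - 1) * ln t)).
        apply Rle_trans with (exp (Re (s - 1) * ln t) * (exp (- t) * (b * b / INR n)))%R; [nra|].
        right; ring.
      - apply (is_RInt_minus (V := C_R_NormedModule) f (fn n) a b _ _ Hz I1).
      - replace (b * b * J / INR n)%R with (b * b / INR n * J)%R by (unfold Rdiv; ring).
        apply (is_RInt_scal (V := R_NormedModule)). exact HJ. }
    assert (B2 : (Cmod (A (INR n) - A b) <= E2)%R).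
    { eapply Rle_trans.
      - apply (Cmod_RInt_le (fn n) (fun t => (M * exp (- t / 2))%R) b (INR n) _ _ Hbn);
          [|exact I2 | apply is_RInt_exp_half].
        intros t Ht. eapply Rle_trans; [|apply HMt; lra].
        unfold fn. rewrite Cmod_mult, Cmod_R, Cmod_Cpower.
        assert (Q := one_minus_div_pow_le_exp t n ltac:(lra) Hn1).
        rewrite Rabs_pos_eq by lra. apply Rmult_le_compat_l; [left; apply exp_pos | lra].
      - unfold E2. assert (P := exp_pos (- INR n / 2)). nra. }
    assert (B3 : (Cmod (A a) <= E1)%R) by (apply euler_primitive_near_0; lra).
    (* The error over (a, b), the tail over (b, n), and the primitive at [a], which stands for the
       part over (0, a). *)
    replace (z - A (INR n)) with ((z - (A b - A a)) + (- (A (INR n) - A b)) + - A a) by ring.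
    eapply Rle_trans; [apply Cmod_triangle|].
    eapply Rle_trans; [apply Rplus_le_compat_r, Cmod_triangle|].
    rewrite !Cmod_opp. lra. }
  assert (LC := Clim_Cmod _ _ (Clim_minus _ _ _ _ (Clim_const z) HG)).
  assert (LR : is_lim_seq (fun n => (E1 + E2 + b * b * J / INR n)%R) (E1 + E2 + 0)%R).
  { apply is_lim_seq_plus'; [apply is_lim_seq_const|].
    apply is_lim_seq_ext with (u := fun n => (b * b * J / INR n ^ 1)%R); [intros; rewrite pow_1; reflexivity|].
    apply is_lim_seq_div_pow; lia. }
  assert (F := is_lim_seq_le_loc _ _ _ _ (ex_intro _ n0 key) LC LR).
  simpl in F. unfold E1, E2 in *. lra.
Qed.

Lemma Gamma_integral_eq (s : C) (G : C) : (0 < Re s)%R ->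
  Clim (fun n => Cpower s (INR n) * INR (fact n) / Cprod (fun k => s + INR k) (S n)) G ->
  Gamma_integral s = G.
Proof.
  intros Hs HG. unfold Gamma_integral.
  apply (is_RInt_gen_unique (V := C_R_CompleteNormedModule)).
  destruct (euler_integral_estimate s G Hs HG) as [M HM].
  unfold is_RInt_gen.
  apply (filterlimi_locally (U := C_UniformSpace)). intros eps.
  assert (H1 : at_right 0 (fun a => (0 < a <= 1 / 2)%R /\ (2 * exp (Re s * ln a) / Re s < eps / 2)%R)).
  (* [d] is [(eps * Re s / 8)^(1 / Re s)], so that [a < d] makes the term at [a] less than
     [eps / 4]. *)
  { set (d := exp (ln (eps * Re s / 8) / Re s)).
    assert (He := cond_pos eps).
    assert (Hd : (0 < Rmin d (1 / 2))%R) by (apply Rmin_pos; [apply exp_pos | lra]).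
    exists (mkposreal _ Hd). intros a Ha Ha0. change (Rabs (a - 0) < Rmin d (1 / 2))%R in Ha.
    rewrite Rminus_0_r, Rabs_pos_eq in Ha by lra.
    assert (A1 := Rmin_l d (1 / 2)). assert (A2 := Rmin_r d (1 / 2)).
    split; [lra|].
    assert (L : (ln a < ln (eps * Re s / 8) / Re s)%R).
    { rewrite <- (ln_exp (ln (eps * Re s / 8) / Re s)). apply ln_increasing; [exact Ha0|].
      fold d. lra. }
    assert (P : (0 < eps * Re s / 8)%R) by (apply Rdiv_lt_0_compat; [apply Rmult_lt_0_compat; lra | lra]).
    assert (L2 : (exp (Re s * ln a) < eps * Re s / 8)%R).
    { rewrite <- (exp_ln _ P) at 1. apply exp_increasing.
      apply (Rmult_lt_compat_l (Re s)) in L; [|exact Hs].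
      replace (Re s * (ln (eps * Re s / 8) / Re s))%R with (ln (eps * Re s / 8)) in L by (field; lra).
      exact L. }
    apply Rmult_lt_reg_r with (Re s); [exact Hs|].
    unfold Rdiv. rewrite Rmult_assoc, Rinv_l by lra. nra. }
  assert (H2 : Rbar_locally p_infty (fun b => (1 <= b)%R /\ (M * exp (- b / 2) < eps / 2)%R)).
  { assert (He := cond_pos eps).
    set (K := (Rabs M + 1)%R). assert (HK : (0 < K)%R) by (unfold K; assert (A := Rabs_pos M); lra).
    assert (P : (0 < eps / 2 / K)%R) by (apply Rdiv_lt_0_compat; lra).
    exists (Rmax 1 (-2 * ln (eps / 2 / K))). intros b Hb.
    assert (A1 := Rmax_l 1 (-2 * ln (eps / 2 / K))). assert (A2 := Rmax_r 1 (-2 * ln (eps / 2 / K))).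
    split; [lra|].
    assert (L : (exp (- b / 2) < eps / 2 / K)%R).
    { rewrite <- (exp_ln _ P) at 1. apply exp_increasing. lra. }
    apply Rle_lt_trans with (K * exp (- b / 2))%R.
    - apply Rmult_le_compat_r; [left; apply exp_pos|]. unfold K. assert (A := Rle_abs M). lra.
    - apply (Rmult_lt_compat_l K) in L; [|exact HK].
      replace (K * (eps / 2 / K))%R with (eps / 2)%R in L by (field; lra). exact L. }
  econstructor; [exact H1 | exact H2 |].
  intros a b [Ha1 Ha2] [Hb1 Hb2]. cbn [fst snd].
  destruct (HM a b Ha1 Hb1) as [z [Hz Hzb]].
  exists z. split; [exact Hz|].
  apply C_NormedModule_mixin_compat1.
  change (Cmod (z - G) < eps)%R. lra.
Qed.

(** * The limit of the product *)

Lemma Clim_inv (x : nat -> C) (l : C) : l <> 0 -> Clim x l -> Clim (fun n => / x n) (/ l).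
Proof.
  intros Hl [H1 H2].
  assert (N : is_lim_seq (fun n => (Re (x n) ^ 2 + Im (x n) ^ 2)%R) (Re l ^ 2 + Im l ^ 2)%R).
  { simpl. apply is_lim_seq_plus'; repeat apply is_lim_seq_mult'; auto using is_lim_seq_const. }
  assert (N0 : (Re l ^ 2 + Im l ^ 2)%R <> 0%R).
  { rewrite <- Cmod2_alt. apply pow_nonzero. apply Cmod_gt_0 in Hl. lra. }
  split; simpl.
  - apply (is_lim_seq_div' _ _ _ _ H1 N N0).
  - apply (is_lim_seq_div' (fun n => (- Im (x n))%R) _ (- Im l)%R); [|exact N | exact N0].
    apply (is_lim_seq_opp _ (Finite (Im l))) in H2. exact H2.
Qed.

Definition harmonic_minus_ln (n : nat) : R :=
  (sum_n_m (fun k => / INR k) 1 n - ln (INR n))%R.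

Lemma harmonic_S (n : nat) :
  (sum_n_m (fun k => / INR k) 1 (S n) = sum_n_m (fun k => / INR k) 1 n + / INR (S n))%R.
Proof. rewrite (sum_n_Sm (G := R_AbelianMonoid)) by lia. reflexivity. Qed.

(** [Lim_seq] and [real] are total, so convergence must be proved before [euler_gamma] means
    anything. From [1/(n+1) <= ln (n+1) - ln n <= 1/n], the increments are at most [1/n^2]. *)
Lemma is_lim_seq_harmonic : is_lim_seq harmonic_minus_ln euler_gamma.
Proof.
  destruct (telescoping_bound (fun n => RtoC (harmonic_minus_ln n)) 1 1 1) as [l [[Hl _] _]];
    try lia.
  { intros n Hn. rewrite <- RtoC_minus, Cmod_R. unfold harmonic_minus_ln. rewrite harmonic_S.
    assert (Hp : (1 <= INR n)%R) by (apply (le_INR 1); lia).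
    rewrite !S_INR. set (x := INR n) in *.
    assert (L1 : (ln (x + 1) - ln x <= / x)%R).
    { rewrite <- ln_div by lra.
      assert (A := exp_ineq1_le (ln ((x + 1) / x))). rewrite exp_ln in A by (apply Rdiv_lt_0_compat; lra).
      replace ((x + 1) / x)%R with (1 + / x)%R in A at 2 by (field; lra). lra. }
    assert (L2 : (/ (x + 1) <= ln (x + 1) - ln x)%R).
    { assert (A := exp_ineq1_le (ln (x / (x + 1)))). rewrite exp_ln in A by (apply Rdiv_lt_0_compat; lra).
      rewrite ln_div in A by lra.
      replace (x / (x + 1))%R with (1 - / (x + 1))%R in A by (field; lra). lra. }
    assert (L3 : (/ x - / (x + 1) <= 1 / x ^ (1 + 1))%R).
    { simpl. apply Rle_trans with (/ (x * (x + 1)))%R; [right; field; lra|].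
      unfold Rdiv. rewrite Rmult_1_l, Rmult_1_r. apply Rinv_le_contravar; nra. }
    apply Rabs_le. lra. }
  unfold euler_gamma.
  change (fun n => (sum_n_m (fun k => / INR k) 1 n - ln (INR n))%R) with harmonic_minus_ln.
  change (is_lim_seq harmonic_minus_ln (Re l)) in Hl.
  rewrite (is_lim_seq_unique _ _ Hl). exact Hl.
Qed.

(* By Gauss's product formula this tends to [1 / Gamma (1 + w)]. *)
Definition gauss_seq (w : C) (n : nat) : C :=
  Cprod (fun k => 1 + w / INR (S k)) n * Cexp (- w * ln (INR n)).

Lemma W_gauss (w : C) (n : nat) : W w 0 n = gauss_seq w n * Cexp (- w * harmonic_minus_ln n).
Proof.
  unfold gauss_seq. rewrite <- Cmult_assoc, <- Cexp_plus.
  replace (- w * ln (INR n) + - w * harmonic_minus_ln n)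
    with (- w * (sum_n_m (fun k => / INR k)%R 1 n : R)).
  2: { unfold harmonic_minus_ln. rewrite RtoC_minus. ring. }
  induction n as [|n IH].
  - rewrite sum_n_m_zero by lia. unfold W; simpl.
    replace (- w * RtoC zero) with (RtoC 0) by (change (RtoC zero) with (RtoC 0); ring).
    rewrite Cexp_0. ring.
  - assert (Q := W_S w 0 n). rewrite Cplus_0_r, Cmult_0_r in Q. rewrite Q, IH, harmonic_S.
    cbn [Cprod]. rewrite RtoC_plus, (Cmult_plus_distr_l (- w)), Cexp_plus.
    rewrite Cdiv_RtoC_inv by (apply not_0_INR; lia). ring.
Qed.

Lemma Clim_Cexp_harmonic (w : C) :
  Clim (fun n => Cexp (w * harmonic_minus_ln n)) (Cexp (w * euler_gamma)).
Proof.
  apply Clim_Cexp, Clim_mult; [apply Clim_const | apply Clim_RtoC, is_lim_seq_harmonic].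
Qed.

(** Convergence is inherited from [W w 0], which differs only by the exponential of a convergent
    sequence; so is the nonvanishing of the limit. *)
Lemma gauss_seq_converges (w : C) :
  exists l : C, Clim (gauss_seq w) l /\ ((forall k, 1 + w / INR (S k) <> 0) -> l <> 0).
Proof.
  destruct (W_asymptotic w 0 0) as [L [err [n0 [M [HL [_ [Hne _]]]]]]].
  rewrite Cplus_0_r, Cmult_0_r in HL, Hne.
  exists (L * Cexp (w * euler_gamma)). split.
  - apply Clim_ext with (2 := Clim_mult _ _ _ _ HL (Clim_Cexp_harmonic w)).
    intros n. rewrite W_gauss, <- Cmult_assoc, <- Cexp_plus.
    replace (- w * harmonic_minus_ln n + w * harmonic_minus_ln n) with (RtoC 0) by ring.
    rewrite Cexp_0. ring.
  - intros H. apply Cmult_neq_0; [|apply Cexp_neq_0]. apply Hne.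
    unfold W. apply Cprod_neq_0. intros k _. cbv zeta.
    apply Cmult_neq_0; [apply Cexp_neq_0|].
    unfold Cdiv at 2. rewrite Cmult_0_l, Cplus_0_r. apply H.
Qed.

Lemma rising_product (w : C) (n : nat) :
  Cprod (fun k => 1 + w + INR k) n = INR (fact n) * Cprod (fun k => 1 + w / INR (S k)) n.
Proof.
  induction n as [|n IH]; [simpl; ring|].
  cbn [Cprod]. rewrite IH, (fact_simpl n), mult_INR, RtoC_mult.
  assert (A := INR_S_neq_0_C n).
  replace (1 + w + INR n) with (INR (S n) * (1 + w / INR (S n))).
  - ring.
  - rewrite S_INR, RtoC_plus in A |- *. field. exact A.
Qed.

Lemma Clim_add_div_INR (c : C) : Clim (fun n => 1 + c * RtoC (/ INR n)) 1.
Proof.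
  assert (H : Clim (fun n => 1 + c * RtoC (/ INR n)) (1 + c * 0)).
  { apply (Clim_plus (fun _ => RtoC 1)); [apply Clim_const|].
    apply (Clim_mult (fun _ => c)); [apply Clim_const|].
    apply Clim_RtoC. apply (is_lim_seq_inv _ p_infty); [apply is_lim_seq_INR | discriminate]. }
  replace (1 + c * 0) with (RtoC 1) in H by ring. exact H.
Qed.

(** The functional equation of [1/Gamma] at finite [n], up to a factor tending to 1. *)
Lemma gauss_seq_shift (w : C) (n : nat) : (1 <= n)%nat ->
  (1 + w) * gauss_seq (w + 1) n = gauss_seq w n * (1 + (1 + w) * RtoC (/ INR n)).
Proof.
  intros Hn. assert (Hp : (0 < INR n)%R) by (apply lt_0_INR; lia).
  assert (E : (1 + w) * Cprod (fun k => 1 + (w + 1) / INR (S k)) n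
     = Cprod (fun k => 1 + w / INR (S k)) n * (1 + w + INR n)).
  { assert (A := INR_fact_neq_0_C n).
    assert (B := Cprod_shift (fun k => 1 + w + INR k) n).
    rewrite (Cprod_ext (fun k => 1 + w + INR (S k)) (fun k => 1 + (w + 1) + INR k)) in B
      by (intros; rewrite S_INR, RtoC_plus; ring).
    cbn [Cprod] in B. rewrite !rising_product in B. simpl (INR 0) in B.
    transitivity (/ INR (fact n) * ((1 + w + 0)
      * (INR (fact n) * Cprod (fun k => 1 + (w + 1) / INR (S k)) n)));
      [field; exact A|].
    rewrite <- B. field. exact A. }
  unfold gauss_seq. rewrite Cmult_assoc, E.
  replace (- (w + 1) * ln (INR n)) with (- w * ln (INR n) + - ln (INR n)) by ring.
  rewrite Cexp_plus, Cexp_opp, Cexp_RtoC, exp_ln, RtoC_inv by lra.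
  assert (RtoC (INR n) <> 0) by (intros H; apply RtoC_inj in H; lra).
  field. assumption.
Qed.

Lemma gauss_seq_shift_limit (w l : C) :
  Clim (gauss_seq (w + 1)) l -> Clim (gauss_seq w) ((1 + w) * l).
Proof.
  intros H. destruct (gauss_seq_converges w) as [l' [Hl' _]].
  replace ((1 + w) * l) with l'; [exact Hl'|].
  apply Clim_unique with (x := fun n => gauss_seq w n * (1 + (1 + w) * RtoC (/ INR n))).
  - replace l' with (l' * 1) by ring. apply Clim_mult; [exact Hl' | apply Clim_add_div_INR].
  - apply Clim_ext_loc with (2 := Clim_mult _ _ _ _ (Clim_const (1 + w)) H).
    exists 1%nat. intros n Hn. apply gauss_seq_shift, Hn.
Qed.

Lemma Gamma_integral_gauss (w l : C) : (0 < Re (1 + w))%R ->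
  Clim (gauss_seq w) l -> Gamma_integral (1 + w) = / l.
Proof.
  intros Hw Hl.
  assert (Hk : forall k, 1 + w + INR k <> 0) by (intros; apply Re_pos_neq_0, Re_plus_INR_pos, Hw).
  assert (Hk' : forall k, 1 + w / INR (S k) <> 0).
  { intros k E. apply (Hk k). assert (A := INR_S_neq_0_C k).
    transitivity (INR (S k) * (1 + w / INR (S k))).
    - rewrite S_INR, RtoC_plus in A |- *. field. exact A.
    - rewrite E. ring. }
  assert (Hne : l <> 0).
  { destruct (gauss_seq_converges w) as [l' [Hl' H]].
    rewrite (Clim_unique _ _ _ Hl Hl'). apply H, Hk'. }
  apply Gamma_integral_eq; [exact Hw|].
  (* Gauss's denominator has the extra factor [1 + w + n]; divided by [n], it accounts for the limit
     1. *)
  replace (/ l) with (/ (l * 1)) by (f_equal; ring).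
  assert (H : Clim (fun n => / (gauss_seq w n * (1 + (1 + w) * RtoC (/ INR n)))) (/ (l * 1))).
  { apply Clim_inv; [rewrite Cmult_1_r; exact Hne|].
    apply Clim_mult; [exact Hl | apply Clim_add_div_INR]. }
  apply Clim_ext_loc with (2 := H).
  exists 1%nat. intros n Hn.
  assert (Hp : (0 < INR n)%R) by (apply lt_0_INR; lia).
  assert (Hn0 : RtoC (INR n) <> 0) by (intros E; apply RtoC_inj in E; lra).
  assert (HP : Cprod (fun k => 1 + w / INR (S k)) n <> 0) by (apply Cprod_neq_0; intros; apply Hk').
  cbn [Cprod]. rewrite rising_product. unfold gauss_seq.
  replace (Cpower (1 + w) (INR n)) with (INR n * Cpower w (INR n))
    by (rewrite <- Cpower_plus_1 by exact Hp; f_equal; ring).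
  unfold Cpower.
  replace (- w * ln (INR n)) with (- (w * ln (INR n))) by ring. rewrite Cexp_opp.
  assert (X := Cexp_neq_0 (w * ln (INR n))).
  rewrite RtoC_inv by lra.
  assert (A := INR_fact_neq_0_C n). assert (B := Hk n).
  replace (1 + (1 + w) * / INR n) with ((1 + w + INR n) / INR n) by (field; exact Hn0).
  field. auto.
Qed.

Lemma Gamma_shift_pos (z : C) : (0 < Re (z + INR (Gamma_shift z)))%R.
Proof.
  unfold Gamma_shift. destruct (archimed (- Re z)) as [A _].
  rewrite re_plus, re_RtoC.
  (* [Z.to_nat] turns a negative integer into 0, which only increases it. *)
  assert (B : (IZR (up (- Re z)) <= INR (Z.to_nat (up (- Re z))))%R).
  { rewrite INR_IZR_INZ. apply IZR_le. lia. }
  lra.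
Qed.

(** Shifting by [m] reaches the right half-plane, where the limit is the inverse of a nonzero
    integral. Coming back only multiplies by [1 + w + k], so nothing is divided by 0 at the poles of
    Gamma. *)
Lemma gauss_seq_Rgamma (w : C) : Clim (gauss_seq w) (Rgamma (1 + w)).
Proof.
  unfold Rgamma. set (m := Gamma_shift (1 + w)).
  assert (H : forall (k : nat) (w l : C), Clim (gauss_seq (w + INR k)) l ->
     Clim (gauss_seq w) (Cprod (fun k => 1 + w + INR k) k * l)).
  { clear. induction k as [|k IH]; intros w l H.
    - simpl. simpl in H. rewrite Cplus_0_r in H. rewrite Cmult_1_l. exact H.
    - rewrite Cprod_shift.
      rewrite (Cprod_ext _ (fun k => 1 + (w + 1) + INR k)) by (intros; rewrite S_INR, RtoC_plus; ring).
      replace (1 + w + INR 0) with (1 + w) by (simpl; ring).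
      rewrite <- Cmult_assoc. apply gauss_seq_shift_limit, IH.
      replace (w + 1 + INR k) with (w + INR (S k)) by (rewrite S_INR, RtoC_plus; ring).
      exact H. }
  destruct (gauss_seq_converges (w + INR m)) as [l [Hl Hne]].
  assert (Hm := Gamma_shift_pos (1 + w)). fold m in Hm.
  rewrite <- Cplus_assoc in Hm |- *.
  rewrite (Gamma_integral_gauss (w + INR m) l Hm Hl).
  unfold Cdiv. replace (/ / l) with l; [apply H, Hl|].
  field. apply Hne. intros k E.
  apply (Re_pos_neq_0 _ (Re_plus_INR_pos _ k Hm)). assert (A := INR_S_neq_0_C k).
  transitivity (INR (S k) * (1 + (w + INR m) / INR (S k))).
  - rewrite (S_INR k), RtoC_plus in A |- *. field. exact A.
  - rewrite E. ring.
Qed.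

Lemma W_limit (u v : C) :
  Clim (W (u + v) (u * v)) (Cexp (- (u + v) * euler_gamma) * Rgamma (1 + u) * Rgamma (1 + v)).
Proof.
  rewrite <- Cmult_assoc.
  apply Clim_ext with (2 := Clim_mult _ _ _ _ (Clim_Cexp_harmonic (- (u + v)))
    (Clim_mult _ _ _ _ (gauss_seq_Rgamma u) (gauss_seq_Rgamma v))).
  intros n. rewrite W_mult, !W_gauss.
  replace (- (u + v) * harmonic_minus_ln n)
    with (- u * harmonic_minus_ln n + - v * harmonic_minus_ln n) by ring.
  rewrite Cexp_plus. ring.
Qed.

(** * The coefficients *)

Lemma bern_coef_2 : bern_coef 2 = (/ 12)%R.
Proof.
  rewrite bern_coef_S, sum_n_f_R0. cbn [sum_f_R0]. rewrite bern_coef_0, bern_coef_1.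
  simpl. field.
Qed.

Lemma bern_coef_3 : bern_coef 3 = 0%R.
Proof.
  rewrite bern_coef_S, sum_n_f_R0. cbn [sum_f_R0]. rewrite bern_coef_0, bern_coef_1, bern_coef_2.
  simpl. field.
Qed.

Lemma bern_diff_2 (u v : C) : bern_diff u v 2 = (u ^ 2 + v ^ 2) / 2 - (u + v) / 2.
Proof.
  unfold bern_diff, bern_poly_coef, conv. rewrite !Csum_S, !Csum_O, bern_coef_0, bern_coef_1.
  unfold exp_coef. simpl. rewrite RtoC_opp, RtoC_inv by lra.
  replace (RtoC (1 + 1)) with (RtoC 2) by (f_equal; ring). field.
Qed.

Lemma bern_diff_3 (u v : C) :
  bern_diff u v 3 = (u ^ 3 + v ^ 3) / 6 - (u ^ 2 + v ^ 2) / 4 + (u + v) / 12.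
Proof.
  unfold bern_diff, bern_poly_coef, conv. rewrite !Csum_S, !Csum_O, bern_coef_0, bern_coef_1, bern_coef_2.
  unfold exp_coef. simpl. rewrite RtoC_opp, !RtoC_inv by lra.
  replace (RtoC (1 + 1 + 1 + 1 + 1 + 1)) with (RtoC 6) by (f_equal; ring).
  replace (RtoC (1 + 1)) with (RtoC 2) by (f_equal; ring). field.
Qed.

Lemma bern_diff_4 (u v : C) :
  bern_diff u v 4 = (u ^ 4 + v ^ 4) / 24 - (u ^ 3 + v ^ 3) / 12 + (u ^ 2 + v ^ 2) / 24.
Proof.
  unfold bern_diff, bern_poly_coef, conv.
  rewrite !Csum_S, !Csum_O, bern_coef_0, bern_coef_1, bern_coef_2, bern_coef_3.
  unfold exp_coef. change (fact (4 - 0)) with 24%nat. change (fact (4 - 1)) with 6%nat.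
  change (fact (4 - 2)) with 2%nat. change (fact (4 - 3)) with 1%nat. change (fact (4 - 4)) with 1%nat.
  rewrite RtoC_opp, !RtoC_inv, !INR_IZR_INZ by lra. simpl. field.
Qed.

Lemma W_coef_S (p q Delta : C) (i : nat) : Delta ^ 2 = p ^ 2 - 4 * q ->
  W_coef p q Delta (S i) = exponent_coef (p / 2 + Delta / 2) (p / 2 - Delta / 2) (S i).
Proof.
  intros HD. set (u := p / 2 + Delta / 2). set (v := p / 2 - Delta / 2).
  assert (Hp : u + v = p) by (unfold u, v; field).
  unfold W_coef, exponent_coef. rewrite Hp. destruct i as [|i].
  - simpl Nat.leb. cbv iota. rewrite bern_diff_2, Hp, bern_coef_1, RtoC_opp, RtoC_inv by lra.
    simpl (INR _). simpl ((- (1)) ^ 1).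
    replace (u ^ 2 + v ^ 2) with ((p ^ 2 + Delta ^ 2) / 2) by (unfold u, v; field).
    rewrite HD. field.
  - simpl Nat.leb. cbv iota. cbn [pred].
    rewrite bernoulli_eq, !bernoulli_poly_eq. unfold bernoulli. rewrite bernoulli_poly_eq.
    (* Parity supplies the sign [(-1)^j] for [B_j]; it holds because [j >= 2], and for [j = 1] the
       formula would be off by [p]. *)
    rewrite <- (bern_coef_parity (S (S i))) at 1 by lia.
    replace (S (S i) + 1)%nat with (S (S (S i))) by lia.
    unfold bern_diff. rewrite (Cpow_S _ (S (S i))).
    rewrite (fact_simpl (S (S i))), (fact_simpl (S i)), !mult_INR, !RtoC_mult.
    assert (A := INR_S_neq_0_C (S i)). assert (B := INR_S_neq_0_C (S (S i))).
    fold u v. generalize ((- (1)) ^ S (S i)) as e. intros e. field. auto.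
Qed.

Lemma exp_asymptotic_ext (F : nat -> C) (K : C) (c c' : nat -> C) :
  (forall j, (1 <= j)%nat -> c j = c' j) -> exp_asymptotic F K c -> exp_asymptotic F K c'.
Proof.
  intros H HF N HN. destruct (HF N HN) as [err [HM [n0 He]]].
  exists err. split; [exact HM|]. exists n0. intros n Hn. rewrite (He n Hn).
  do 3 f_equal. apply (sum_n_m_ext_loc (G := C_AbelianMonoid)). intros k [Hk _]. rewrite H by exact Hk.
  reflexivity.
Qed.

Theorem theorem2p1 :
  forall p q Delta : C,
    (Delta ^ 2 = p ^ 2 - 4 * q)%C ->
    let a2 := (- (p ^ 3 / 6) + p * q / 2 + p ^ 2 / 4 - q / 2)%C in
    let a3 := (p ^ 4 / 12 - p ^ 2 * q / 3 + q ^ 2 / 6 - p ^ 3 / 6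
               + p * q / 2 + p ^ 2 / 12 - q / 6)%C in
    exp_asymptotic (W p q) (W_const p Delta) (W_coef p q Delta) /\
    (W_coef p q Delta 2 = a2 /\ W_coef p q Delta 3 = a3) /\
    exp_asymptotic (W p q) (W_const p Delta)
      (fun j => match j with
                | 1 => (p ^ 2 / 2 - q)%C
                | 2 => a2
                | 3 => a3
                | _ => W_coef p q Delta j
                end).
Proof.
  intros p q Delta HD a2 a3.
  set (u := p / 2 + Delta / 2). set (v := p / 2 - Delta / 2).
  assert (Hp : u + v = p) by (unfold u, v; field).
  assert (Hq : u * v = q).
  { transitivity ((p ^ 2 - Delta ^ 2) / 4); [unfold u, v; field|]. rewrite HD. field. }
  assert (H : exp_asymptotic (W p q) (W_const p Delta) (W_coef p q Delta)).
  { intros N HN. destruct N as [|P]; [lia|].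
    destruct (W_asymptotic u v P) as [L [err [n0 [M [HL [Hn0 [_ He]]]]]]].
    (* [L] was obtained separately for each order; uniqueness of limits makes it the same constant
       for all. *)
    assert (EL : L = W_const p Delta).
    { rewrite (Clim_unique _ _ _ HL (W_limit u v)), Hp. unfold W_const.
      f_equal; [f_equal|]; f_equal; unfold u, v; ring. }
    exists err. split.
    - exists M, n0. intros n Hn. replace (S P + 1)%nat with (P + 2)%nat by lia. apply He, Hn.
    - exists n0. intros n Hn. rewrite <- EL.
      replace (W p q n) with (W (u + v) (u * v) n) by (rewrite Hp, Hq; reflexivity).
      rewrite (proj2 (He n Hn)).
      do 3 f_equal. unfold Csum1. rewrite <- sum_n_m_S.
      apply (sum_n_m_ext (G := C_AbelianMonoid)). intros i.
      rewrite (W_coef_S p q Delta i HD). fold u v.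
      rewrite Nat.add_1_r, RtoC_inv, Cpow_inv by (try apply INR_S_neq_0_C; apply not_0_INR; lia).
      reflexivity. }
  assert (P2 : u ^ 2 + v ^ 2 = p ^ 2 - 2 * q) by (rewrite <- Hp, <- Hq; ring).
  assert (P3 : u ^ 3 + v ^ 3 = p ^ 3 - 3 * p * q) by (rewrite <- Hp, <- Hq; ring).
  assert (P4 : u ^ 4 + v ^ 4 = p ^ 4 - 4 * p ^ 2 * q + 2 * q ^ 2) by (rewrite <- Hp, <- Hq; ring).
  assert (H2 : W_coef p q Delta 2 = a2).
  { rewrite W_coef_S by exact HD. fold u v. unfold exponent_coef.
    rewrite bern_diff_3, P3, P2, Hp, bern_coef_2, RtoC_inv by lra. simpl (INR _). unfold a2. field. }
  assert (H3 : W_coef p q Delta 3 = a3).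
  { rewrite W_coef_S by exact HD. fold u v. unfold exponent_coef.
    rewrite bern_diff_4, P4, P3, P2, Hp, bern_coef_3. simpl (INR _).
    replace (RtoC (1 + 1)) with (RtoC 2) by (f_equal; ring). unfold a3. field. }
  split; [exact H|]. split; [split; assumption|].
  apply exp_asymptotic_ext with (2 := H).
  intros j Hj. destruct j as [|[|[|[|j]]]]; [lia | reflexivity | exact H2 | exact H3 | reflexivity].
Qed.
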